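(* Let $k$ be a field and let $\mathcal A$ be a finite set of hyperplanes through the origin in $\mathbb R^d$, with face semigroup algebra $k\mathcal F$. Then $k\mathcal F$ admits a grading making it a Koszul algebra.
   Context: For each $H\in\mathcal A$ fix a labelling $H^+,H^-$ of the two open half-spaces determined by $H$, and put $H^0=H$. A face of $\mathcal A$ is a nonempty set of the form $x=\bigcap_{H\in\mathcal A}H^{\sigma_H}$ with $\sigma_H\in\{+,-,0\}$; write $\sigma_H(x)=\sigma_H$. $\mathcal F$ is the set of faces. The product $xy$ of faces is the face with $\sigma_H(xy)=\sigma_H(x)$ if $\sigma_H(x)\ne0$ and $\sigma_H(xy)=\sigma_H(y)$ if $\sigma_H(x)=0$. This makes $\mathcal F$ a semigroup with identity $1=\bigcap_{H\in\mathcal A}H$, and $k\mathcal F$ is its semigroup algebra over $k$. A graded $k$-algebra is a $k$-algebra with a vector space decomposition $A=\bigoplus_{i\ge0}A_i$ with $A_iA_j\subset A_{i+j}$; $A_0$ is regarded as an $A$-module via $A_0\cong A/\bigoplus_{i>0}A_i$. A graded $A$-module is an $A$-module $M=\bigoplus_{i\in\mathbb Z}M_i$ with $A_iM_j\subset M_{i+j}$; it is generated in degree $i$ if $M_j=0$ for $j<i$ and $M_j=A_{j-i}M_i$ for $j\ge i$. A morphism $f:M\to N$ of graded modules has degree $p$ if $f(M_i)\subset N_{i+p}$ for all $i$. A graded $A$-module $M$ has a linear resolution if it admits a projective resolution $\cdots\to P_2\xrightarrow{d_2}P_1\xrightarrow{d_1}P_0\xrightarrow{d_0}M\to0$ with $P_i$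 a graded $A$-module generated in degree $i$ and $d_i$ of degree $0$, for all $i\ge0$. A graded $k$-algebra $A$ is a Koszul algebra if $A_0$ is a semisimple $k$-algebra and $A_0$, considered as a graded $A$-module concentrated in degree $0$, admits a linear resolution. *)

(* Defs.v *)
From HB Require Import structures.
From mathcomp Require Import all_boot all_order all_algebra.
From mathcomp Require Import finmap.
From mathcomp Require Import boolp classical_sets reals.
From mathcomp Require Import monalg.

Set Implicit Arguments.
Unset Strict Implicit.
Unset Printing Implicit Defensive.

Import Order.TTheory GRing.Theory Num.Theory.
Local Open Scope ring_scope.

(* V is the internal direct sum of the C i; only used for families of
   subgroups or subspaces. *)
Definition is_direct_sum (I : choiceType) (V : zmodType) (C : I -> {pred V}) :=
  forall v : V, exists! c : {fsfun I -> V with 0},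
    (forall i, c i \in C i) /\ v = \sum_(i <- finsupp c) c i.

Section DirectSum.
Variables (I : choiceType) (V : zmodType) (C : I -> {pred V}).
Hypothesis C_closed : forall i, GRing.zmod_closed (C i).
Hypothesis C_direct : is_direct_sum C.

Definition component (v : V) (i : I) : V := sval (cid (C_direct v)) i.

Lemma component_mem v i : component v i \in C i.
Proof. by rewrite /component; case: cid => c /= [[]]. Qed.

Lemma fsum_widen (c : {fsfun I -> V with 0}) (D : {fset I}) :
  (finsupp c `<=` D)%fset -> \sum_(i <- finsupp c) c i = \sum_(i <- D) c i.
Proof. by move=> sD; apply: big_fset_incl => // i _ /fsfun_dflt. Qed.

Lemma component_uniq v (D : {fset I}) (c : I -> V) :
    (forall i, c i \in C i) -> (forall i, i \notin D -> c i = 0) ->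
  v = \sum_(i <- D) c i -> forall i, component v i = c i.
Proof.
move=> cC c0 vE i; rewrite /component; case: cid => c' /= [_ uc'].
pose c1 : {fsfun I -> V with 0} := [fsfun j in D => c j].
have c1E j : c1 j = c j by rewrite fsfun_fun; case: ifPn => // /c0 ->.
rewrite (uc' c1) //; split=> [j|]; first by rewrite c1E.
rewrite vE (@fsum_widen _ D); last exact: finsupp_sub.
by apply: eq_bigr => j _; rewrite c1E.
Qed.

Lemma component_sum v :
  exists D : {fset I}, v = \sum_(i <- D) component v i.
Proof. by rewrite /component; case: cid => c /= [[_ vE] _]; exists (finsupp c). Qed.

Lemma component_hom i v : v \in C i ->
  forall j, component v j = if j == i then v else 0.
Proof.
move=> vC; apply: (@component_uniq _ [fset i]%fset) => [j|j|].
- by case: eqP => [->//|_]; case: (C_closed j).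
- by rewrite inE; case: eqP.
- by rewrite big_seq_fset1 eqxx.
Qed.

Lemma componentB u v i : component (u - v) i = component u i - component v i.
Proof.
move: i; case: (cid (C_direct u)) (cid (C_direct v)) => c [[cC uE] _] [c' [[cC' vE] _]].
have E w (d : {fsfun I -> V with 0}) : (forall i, d i \in C i) ->
    w = \sum_(i <- finsupp d) d i -> forall i, component w i = d i.
  move=> dC wE; apply: (@component_uniq _ (finsupp d)) => // i.
  exact: fsfun_dflt.
move=> i; rewrite (E u c) // (E v c') //; move: i.
apply: (@component_uniq _ (finsupp c `|` finsupp c')%fset).
- by move=> i; apply: (C_closed i).2.
- by move=> i; rewrite in_fsetU negb_or => /andP[/fsfun_dflt-> /fsfun_dflt->]; rewrite subr0.
rewrite uE vE (fsum_widen (fsubsetUl _ (finsupp c'))).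
by rewrite (fsum_widen (fsubsetUr (finsupp c) _)) -sumrB.
Qed.

End DirectSum.

Section Modules.
Variable S : nzRingType.

Definition simple_submodule (M : lmodType S) (N : {pred M}) :=
  [/\ GRing.submod_closed N, exists2 x, x \in N & x != 0 &
      forall N' : {pred M}, GRing.submod_closed N' -> {subset N' <= N} ->
        (forall x, x \in N' -> x = 0) \/ {subset N <= N'}].

Definition semisimple_module (M : lmodType S) :=
  exists (I : choiceType) (N : I -> {pred M}),
    (forall i, simple_submodule (N i)) /\ is_direct_sum N.

Definition projective_module (P : lmodType S) :=
  forall (M N : lmodType S) (g : {linear M -> N}) (f : {linear P -> N}),
    (forall n, exists m, g m = n) ->
  exists h : {linear P -> M}, forall p, g (h p) = f p.

End Modules.

Definition semisimple_ring (S : nzRingType) := semisimple_module S^o.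

Record grading (k : fieldType) (A : algType k) := Grading {
  gcomp :> nat -> {pred A};
  gcomp_submod : forall i, GRing.submod_closed (gcomp i);
  gcomp_direct : is_direct_sum gcomp;
  gcompM : forall i j a b,
    a \in gcomp i -> b \in gcomp j -> a * b \in gcomp (i + j)%N
}.

(* The components of a graded module are only required to be subgroups: they
   are k-subspaces because k1 is contained in A_0, see [grading_one]. *)
Record module_grading (k : fieldType) (A : algType k) (G : grading A)
    (M : lmodType A) := ModuleGrading {
  mcomp :> int -> {pred M};
  mcomp_zmod : forall j, GRing.zmod_closed (mcomp j);
  mcomp_direct : is_direct_sum mcomp;
  mcompZ : forall (i : nat) (j : int) (a : A) (m : M),
    a \in G i -> m \in mcomp j -> a *: m \in mcomp (i%:Z + j)
}.

Section GradedModules.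
Variables (k : fieldType) (A : algType k) (G : grading A).

Definition prod_span (M : lmodType A) (S : {pred A}) (T : {pred M}) (m : M) :=
  exists s : seq (A * M),
    (forall p, p \in s -> p.1 \in S /\ p.2 \in T) /\
    m = \sum_(p <- s) p.1 *: p.2.

Definition generated_in_degree (M : lmodType A) (gM : module_grading G M)
    (i : int) :=
  (forall j m, j < i -> m \in gM j -> m = 0) /\
  (forall (n : nat) m, m \in gM (i + n%:Z) <-> prod_span (G n) (gM i) m).

Definition has_degree (M N : lmodType A) (gM : module_grading G M)
    (gN : module_grading G N) (p : int) (f : M -> N) :=
  forall i m, m \in gM i -> f m \in gN (i + p).

Definition has_linear_resolution (M : lmodType A) (gM : module_grading G M) :=
  exists (P : nat -> lmodType A) (gP : forall i, module_grading G (P i))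
      (d0 : {linear P 0%N -> M}) (d : forall i, {linear P i.+1 -> P i}),
  [/\ forall i, projective_module (P i),
      forall i, generated_in_degree (gP i) i%:Z,
      has_degree (gP 0%N) gM 0 d0 /\
        (forall i, has_degree (gP i.+1) (gP i) 0 (d i)),
      forall m, exists x, d0 x = m &
      (forall x, d0 x = 0 <-> exists y, d 0%N y = x) /\
        (forall i x, d i x = 0 <-> exists y, d i.+1 y = x)].

Lemma gcomp_zmod i : GRing.zmod_closed (G i).
Proof. exact: GRing.submod_closedB (gcomp_submod G i). Qed.

Definition gproj (a : A) (i : nat) : A := component (@gcomp_direct _ _ G) a i.

Lemma gproj_mem a i : gproj a i \in G i.
Proof. exact: component_mem. Qed.

Lemma gproj_hom i a : a \in G i -> forall j, gproj a j = if j == i then a else 0.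
Proof. exact: component_hom gcomp_zmod _ _ _. Qed.

Lemma gproj_is_additive i : zmod_morphism (gproj^~ i).
Proof. by move=> a b; apply: componentB; apply: gcomp_zmod. Qed.

Lemma gproj0 i : gproj 0 i = 0.
Proof. by have := gproj_is_additive i 0 0; rewrite !subrr. Qed.

Lemma gprojD a b i : gproj (a + b) i = gproj a i + gproj b i.
Proof.
rewrite -[b in LHS]opprK gproj_is_additive -[- b]sub0r gproj_is_additive gproj0.
by rewrite sub0r opprK.
Qed.

Lemma gproj_sum (I : Type) (r : seq I) (F : I -> A) i :
  gproj (\sum_(j <- r) F j) i = \sum_(j <- r) gproj (F j) i.
Proof. exact: (big_morph (gproj^~ i) (fun a b => gprojD a b i) (gproj0 i)). Qed.

Lemma gprojE a : exists D : {fset nat}, a = \sum_(i <- D) gproj a i.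
Proof. exact: component_sum. Qed.

Lemma gproj0_sum a (D : {fset nat}) : a = \sum_(i <- D) gproj a i ->
  gproj a 0%N = \sum_(i <- D) (if i == 0%N then gproj a i else 0).
Proof.
move=> {1}->; rewrite gproj_sum; apply: eq_bigr => i _.
by rewrite (gproj_hom (gproj_mem _ _)) eq_sym.
Qed.

Lemma gproj0M a b : gproj (a * b) 0%N = gproj a 0%N * gproj b 0%N.
Proof.
have [D aE] := gprojE a; have [E bE] := gprojE b.
rewrite (gproj0_sum aE) (gproj0_sum bE) {1}aE {1}bE.
rewrite !mulr_suml gproj_sum; apply: eq_bigr => i _.
rewrite !mulr_sumr gproj_sum; apply: eq_bigr => j _.
rewrite (gproj_hom (gcompM (gproj_mem a i) (gproj_mem b j))).
rewrite eq_sym addn_eq0; case: (i == _); case: (j == _) => //=.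
- by rewrite mulr0.
- by rewrite mul0r.
- by rewrite mulr0.
Qed.

Lemma grading_one : 1 \in G 0%N.
Proof.
have [D oneE] := gprojE 1.
have hom i a : a \in G i -> a * gproj 1 0%N = a.
  move=> aG; rewrite -[RHS](_ : gproj a i = a); last by rewrite (gproj_hom aG) eqxx.
  rewrite -[a in RHS]mulr1 {2}oneE (gproj0_sum oneE) !mulr_sumr gproj_sum.
  apply: eq_bigr => j _; rewrite (gproj_hom (gcompM aG (gproj_mem 1 j))).
  rewrite -{1}[i]addn0 eqn_add2l eq_sym.
  by rewrite (fun_if ( *%R a)) mulr0.
suff -> : 1 = gproj 1 0%N by exact: gproj_mem.
rewrite -[RHS]mul1r {1 2}oneE mulr_suml; apply: eq_bigr => i _.
by rewrite (hom i) // gproj_mem.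
Qed.

Lemma grading_subalg : GRing.subalg_closed (G 0%N).
Proof.
have [Gz GZ] := gcomp_submod G 0%N.
by split; [exact: grading_one | exact: GZ | move=> a b; apply: gcompM].
Qed.

Record deg0 : predArgType := Deg0 { deg0_val : A; _ : deg0_val \in G 0%N }.

HB.instance Definition _ := [isSub for deg0_val].
HB.instance Definition _ := [Choice of deg0 by <:].
HB.instance Definition _ := GRing.SubChoice_isSubAlgebra.Build k A (G 0%N) deg0
  (GRing.subalg_closed_semi grading_subalg).

(* A_0 as an A-module through A -> A/(\bigoplus_(i > 0) A_i) = A_0: an element
   a acts as multiplication by its degree 0 component. *)
Definition deg0_module : Type := deg0.

HB.instance Definition _ := GRing.Zmodule.on deg0_module.

Definition deg0_act (a : A) (x : deg0_module) : deg0_module :=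
  Deg0 (gproj_mem a 0%N) * (x : deg0).

Fact deg0_actA a b x : deg0_act a (deg0_act b x) = deg0_act (a * b) x.
Proof. by apply: val_inj; rewrite /= gproj0M mulrA. Qed.

Fact deg0_act1 : left_id 1 deg0_act.
Proof. by move=> x; apply: val_inj; rewrite /= (gproj_hom grading_one) eqxx mul1r. Qed.

Fact deg0_actDr : right_distributive deg0_act +%R.
Proof. by move=> a x y; rewrite /deg0_act mulrDr. Qed.

Fact deg0_actDl x : {morph deg0_act^~ x : a b / a + b}.
Proof. by move=> a b; apply: val_inj; rewrite /= gprojD mulrDl. Qed.

HB.instance Definition _ := GRing.Zmodule_isLmodule.Build A deg0_module
  deg0_actA deg0_act1 deg0_actDr deg0_actDl.

Definition deg0_comp (j : int) : {pred deg0_module} :=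
  [pred x | (j == 0) || (x == 0)].

Fact deg0_comp_zmod j : GRing.zmod_closed (deg0_comp j).
Proof.
split=> [|x y]; rewrite !inE ?eqxx ?orbT //.
by case: (j == 0) => //= /eqP-> /eqP->; rewrite subrr.
Qed.

Fact deg0_comp_direct : is_direct_sum deg0_comp.
Proof.
move=> v; pose c : {fsfun int -> deg0_module with 0} :=
  [fsfun j in [fset (0 : int)]%fset => v].
have cE j : c j = if j == 0 then v else 0 by rewrite fsfun_fun inE.
exists c; split; first split.
- by move=> j; rewrite inE cE; case: eqP => //= _; rewrite eqxx.
- by rewrite (fsum_widen (finsupp_sub _ _ _)) big_seq_fset1 cE eqxx.
move=> c' [c'C vE]; apply/fsfunP => j; rewrite cE.
have c'0 i : i != 0 -> c' i = 0 by move=> i0; move: (c'C i); rewrite inE (negbTE i0) => /eqP.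
case: eqP => [->|/eqP/c'0 //]; rewrite vE.
rewrite (fsum_widen (fsubsetUl _ [fset (0 : int)]%fset)).
rewrite (big_fsetD1 0) /=; last by rewrite !inE eqxx orbT.
rewrite big1_seq ?addr0 // => i; rewrite !inE => /andP[_ /andP[i0 _]].
exact: c'0.
Qed.

Fact deg0_compZ (i : nat) (j : int) (a : A) (x : deg0_module) :
  a \in G i -> x \in deg0_comp j -> a *: x \in deg0_comp (i%:Z + j).
Proof.
move=> aG; rewrite !inE => /orP[/eqP->|/eqP->]; last by rewrite scaler0 eqxx orbT.
rewrite addr0; case: i aG => [//|i aG] /=; apply/eqP/val_inj => /=.
by rewrite (gproj_hom aG) mul0r.
Qed.

Definition deg0_grading : module_grading G deg0_module :=
  ModuleGrading deg0_comp_zmod deg0_comp_direct deg0_compZ.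

Definition koszul := semisimple_ring deg0 /\ has_linear_resolution deg0_grading.

End GradedModules.

Inductive sign := Plus | Minus | Zero.

HB.instance Definition _ := gen_eqMixin sign.
HB.instance Definition _ := gen_choiceMixin sign.

Section Faces.
Local Open Scope classical_set_scope.
Variables (R : realType) (d : nat) (A : {fset {vspace 'rV[R]_d}}).

(* A labelling H^+, H^- of the half-spaces determined by H is given by a linear
   form with kernel H: H^+ is where it is positive, H^- where it is negative. *)
Record labelling := Labelling {
  lform : A -> 'Hom('rV[R]_d, R^o);
  lform_ker : forall H : A, lker (lform H) = val H
}.

Variable L : labelling.

Definition halfspace (H : A) (s : sign) : set 'rV[R]_d :=
  match s with
  | Plus => [set v | 0 < (lform L H v : R)]
  | Minus => [set v | (lform L H v : R) < 0]
  | Zero => [set v | v \in val H]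
  end.

Definition cell (sigma : A -> sign) : set 'rV[R]_d :=
  \bigcap_H halfspace H (sigma H).

Record face := Face {
  face_set :> set 'rV[R]_d;
  face_neq0 : face_set !=set0;
  face_cell : exists sigma, face_set = cell sigma
}.

HB.instance Definition _ := gen_eqMixin face.
HB.instance Definition _ := gen_choiceMixin face.

Definition face_sign (x : face) : A -> sign := sval (cid (face_cell x)).

Lemma face_setE (x : face) : face_set x = cell (face_sign x).
Proof. by rewrite /face_sign; case: cid. Qed.

Lemma lform_eq0 H v : (lform L H v == 0) = (v \in val H).
Proof. by rewrite -(lform_ker L) memv_ker. Qed.

Lemma halfspace_inj H s t v : halfspace H s v -> halfspace H t v -> s = t.
Proof.
by case: s; case: t => //=; rewrite -?lform_eq0; case: ltgtP.
Qed.

Lemma halfspace_ex H v : exists s, halfspace H s v.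
Proof.
case: (ltgtP (lform L H v : R) 0) => h; [by exists Minus | by exists Plus|].
by exists Zero; rewrite /= -lform_eq0 h.
Qed.

Lemma cell_inj (s t : A -> sign) : cell s !=set0 -> cell s = cell t -> s = t.
Proof.
move=> [v sv] st; have tv : cell t v by rewrite -st.
by apply/funext => H; apply: halfspace_inj (sv H I) (tv H I).
Qed.

Lemma face_signE (x : face) s : face_set x = cell s -> face_sign x = s.
Proof. by move=> xE; apply: cell_inj; rewrite -face_setE //; exact: face_neq0. Qed.

Lemma face_inj (x y : face) : face_sign x = face_sign y -> x = y.
Proof.
move=> xy; have: face_set x = face_set y by rewrite !face_setE xy.
case: x y {xy} => x p q [y p' q'] /= E; case: _ / E p' q' => p' q'.
by rewrite (Prop_irrelevance p p') (Prop_irrelevance q q').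
Qed.

Definition sign_mul (s t : sign) : sign := if s is Zero then t else s.

Definition sign_prod (s t : A -> sign) : A -> sign :=
  fun H => sign_mul (s H) (t H).

Lemma cell_mul_neq0 (s t : A -> sign) :
  cell s !=set0 -> cell t !=set0 -> cell (sign_prod s t) !=set0.
Proof.
move=> [p sp] [q tq].
pose r H : R := `|lform L H q : R| / `|lform L H p : R|.
pose e : R := (1 + \sum_H r H)^-1.
have r0 H : 0 <= r H by rewrite /r divr_ge0.
have S0 : 0 < 1 + \sum_H r H by rewrite ltr_pwDl // sumr_ge0.
have e0 : 0 < e by rewrite invr_gt0.
exists (p + e *: q) => H _; move: (sp H I) (tq H I).
have small : (lform L H p : R) != 0 -> `|e * (lform L H q : R)| < `|lform L H p : R|.
  move=> p0; rewrite normrM gtr0_norm // mulrC ltr_pdivrMr // mulrC.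
  rewrite -ltr_pdivrMr ?normr_gt0 // -/(r H) (bigD1 H) //=.
  rewrite addrCA ltrDl ltr_pwDl // sumr_ge0 //.
rewrite /sign_prod; case: (s H) => /= hp.
- move=> _; have := small (lt0r_neq0 hp); rewrite linearD linearZ /=.
  rewrite [ `|lform L H p : R|]gtr0_norm // ltr_norml => /andP[h _].
  by rewrite -ltrBlDl sub0r.
- move=> _; have := small (ltr0_neq0 hp); rewrite linearD linearZ /=.
  rewrite [ `|lform L H p : R|]ltr0_norm // ltr_norml => /andP[_ h].
  by rewrite -ltrBrDl sub0r.
have p0 : lform L H p = 0 by apply/eqP; rewrite lform_eq0.
case: (t H) => /=; rewrite -?lform_eq0 linearD linearZ /= p0 add0r => hq.
- exact: mulr_gt0.
- by rewrite pmulr_rlt0.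
- by rewrite (eqP hq) scaler0.
Qed.

Lemma face_mul_neq0 (x y : face) :
  cell (sign_prod (face_sign x) (face_sign y)) !=set0.
Proof. by apply: cell_mul_neq0; rewrite -face_setE; apply: face_neq0. Qed.

Definition face_mul (x y : face) : face :=
  Face (face_mul_neq0 x y) (ex_intro _ _ erefl).

Lemma cell_zero_neq0 : cell (fun=> Zero) !=set0.
Proof. by exists 0 => H _ /=; rewrite mem0v. Qed.

Definition face_one : face := Face cell_zero_neq0 (ex_intro _ _ erefl).

Lemma face_sign_mul x y :
  face_sign (face_mul x y) = sign_prod (face_sign x) (face_sign y).
Proof. exact: face_signE. Qed.

Lemma face_sign_one : face_sign face_one = (fun=> Zero).
Proof. exact: face_signE. Qed.

Fact face_mulA : associative face_mul.
Proof.
move=> x y z; apply: face_inj; rewrite !face_sign_mul /sign_prod.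
by apply/funext => H; case: (face_sign x H).
Qed.

Fact face_mul1 : left_id face_one face_mul.
Proof. by move=> x; apply: face_inj; rewrite face_sign_mul face_sign_one. Qed.

Fact face_mulr1 : right_id face_one face_mul.
Proof.
move=> x; apply: face_inj; rewrite face_sign_mul face_sign_one /sign_prod.
by apply/funext => H; case: (face_sign x H).
Qed.

Fact face_unit x y : face_mul x y = face_one -> x = face_one /\ y = face_one.
Proof.
move=> /(congr1 face_sign); rewrite face_sign_mul face_sign_one => xy.
by split; apply: face_inj; rewrite face_sign_one; apply/funext => H;
  move: (congr1 (@^~ H) xy); rewrite /sign_prod; case: (face_sign x H).
Qed.

HB.instance Definition _ := Choice_isMonomialDef.Build face
  face_mulA face_mul1 face_mulr1 face_unit.

Variable k : fieldType.

Definition face_algebra : Type := {malg k[face]}.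

HB.instance Definition _ := GRing.Lalgebra.on face_algebra.

Fact face_algebra_scalerAr (c : k) (x y : face_algebra) :
  c *: (x * y) = x * (c *: y).
Proof.
apply/malgP => z; rewrite mcoeffZ.
rewrite (mcoeffMlw z (fsubset_refl (msupp x)) (fsubset_refl (msupp y))).
rewrite (mcoeffMlw z (fsubset_refl (msupp x)) (msuppZ_le c y)).
rewrite mulr_sumr; apply: eq_bigr => i _; rewrite mulr_sumr; apply: eq_bigr => j _.
by rewrite mcoeffZ mulrnAr mulrCA.
Qed.

HB.instance Definition _ :=
  GRing.Lalgebra_isAlgebra.Build k face_algebra face_algebra_scalerAr.

End Faces.

(* Main.v *)
Require Import Defs.
From HB Require Import structures.
From mathcomp Require Import all_boot all_order all_algebra.
From mathcomp Require Import finmap.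
From mathcomp Require Import boolp classical_sets reals.
From mathcomp Require Import monalg zify ring lra.

Set Implicit Arguments.
Unset Strict Implicit.
Unset Printing Implicit Defensive.

Import Order.TTheory GRing.Theory Num.Theory.
Local Open Scope ring_scope.

(** A face x spans a flat, the intersection of the hyperplanes through x. Each flat X
    has a simple module S_X = k, on which a face acts as 1 if it lies in X and as
    0 otherwise. The proof has a geometric half, which resolves every S_X, and an
    algebraic half, which finds a grading for which these resolutions are linear.

    Geometry. Let K_Y be the span of the faces spanning the flat Y, where a face
    w sends x to w x if w lies in Y, and to 0 otherwise. The cellular chain
    complex of the zonotope dual to the arrangement in Z consists of the modules
    K_Y for Y contained in Z, in degree the codimension of Y in Z. Its boundary
    map sends x in K_X to the sum, over the flats Y in Z that contain X and have
    one dimension more, of x f - x f', where f and f' are the faces containing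
    u(Y) and - u(Y) for a chosen vector u(Y) of Y. It commutes with the faces
    ([act_bdry1]). If the vectors u(Y) come from a generic complete flag of
    subspaces ([generic_directions]), then for T of dimension two more than X the
    u(Y) with Y between X and T lie on a line with direction u(T), and the square
    of the boundary map telescopes along this line to 0 ([pencil], [bdry_sq]).
    The complex, augmented to S_Z, is exact because the same holds for the faces
    in any convex region of Z cut out by some of the hyperplanes: another
    hyperplane cuts such a region into two sides and a wall, and a Mayer-Vietoris
    argument applies ([exact_at_cut], [bdry_exact]).

    Algebra. The face algebra A has orthogonal idempotents e_X indexed by the
    flats, with sum 1, such that e_X A e_Y = 0 unless X is contained in Y, and
    e_X A e_X = k e_X ([idemM], [idem_mul_idem_kill], [idem_line]). Placing
    e_X A e_Y in degree dim Y - dim X is therefore a grading by natural numbers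
    with A_0 the sum of the lines k e_X, a semisimple ring ([semisimple_deg0]).
    Moreover K_X is isomorphic to A e_X, so it is projective and generated in
    degree 0 ([res_projective], [res_generated]). A map from A e_X to A e_Y is
    right multiplication by an element of e_X A e_Y, so the boundary maps above,
    where dim Y - dim X = 1, have degree 1; after shifting the p-th term by p
    they have degree 0. The sum over all Z of the resolutions of S_Z is thus a
    linear resolution of A_0 ([res_linear_resolution]). *)

(** * Linear extension from a basis *)

Section LinearExtension.
Variables (k : fieldType) (K : choiceType) (V : lmodType k).

Definition lin (f : K -> V) (c : {malg k[K]}) : V :=
  \sum_(x <- msupp c) c@_x *: f x.

Lemma linEw f (c : {malg k[K]}) (D : {fset K}) : (msupp c `<=` D)%fset ->
  lin f c = \sum_(x <- D) c@_x *: f x.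
Proof.
move=> sD; apply: big_fset_incl => // x _ xc.
by rewrite mcoeff_outdom // scale0r.
Qed.

Fact lin_is_linear f : linear (lin f).
Proof.
move=> a b c; pose D := (msupp b `|` msupp c)%fset.
have sb : (msupp b `<=` D)%fset := fsubsetUl _ _.
have sc : (msupp c `<=` D)%fset := fsubsetUr _ _.
rewrite (@linEw f (a *: b + c) D); last first.
  apply: fsubset_trans (msuppD_le _ _) _; apply: fsetSU; exact: msuppZ_le.
rewrite (linEw _ sb) (linEw _ sc) scaler_sumr -big_split /=.
by apply: eq_bigr => x _; rewrite mcoeffD mcoeffZ scalerDl scalerA.
Qed.

HB.instance Definition _ f :=
  GRing.isLinear.Build k {malg k[K]} V *:%R (lin f) (lin_is_linear f).

Lemma linP f a b c : lin f (a *: b + c) = a *: lin f b + lin f c.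
Proof. exact: lin_is_linear. Qed.

Lemma lin0 f : lin f 0 = 0.
Proof. exact: linear0. Qed.

Lemma linB f a b : lin f (a - b) = lin f a - lin f b.
Proof. exact: linearB. Qed.

Lemma lin_sum f (I : Type) (r : seq I) (P : pred I) (F : I -> {malg k[K]}) :
  lin f (\sum_(i <- r | P i) F i) = \sum_(i <- r | P i) lin f (F i).
Proof. exact: linear_sum. Qed.

Lemma linU f x : lin f << x >> = f x.
Proof. by rewrite /lin msuppU oner_eq0 big_seq_fset1 mcoeffUU scale1r. Qed.

Lemma malgU_scale (a : k) (x : K) : << a *g x >> = a *: << x >> :> {malg k[K]}.
Proof. by apply/malgP => y; rewrite mcoeffZ !mcoeffU mulr_natr. Qed.

Lemma malg_sum (c : {malg k[K]}) :
  c = \sum_(x <- msupp c) c@_x *: << x >>.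
Proof. by rewrite {1}[c]monalgE; apply: eq_bigr => x _; exact: malgU_scale. Qed.

Lemma linear_eq_in (g h : {malg k[K]} -> V) c : linear g -> linear h ->
  (forall x, x \in msupp c -> g << x >> = h << x >>) -> g c = h c.
Proof.
move=> gl hl gh.
pose gL := GRing.isLinear.Build k {malg k[K]} V *:%R g gl.
pose hL := GRing.isLinear.Build k {malg k[K]} V *:%R h hl.
pose g' : {linear {malg k[K]} -> V} := HB.pack g gL.
pose h' : {linear {malg k[K]} -> V} := HB.pack h hL.
rewrite -[g c]/(g' c) -[h c]/(h' c) [c]malg_sum !linear_sum big_seq [RHS]big_seq.
by apply: eq_bigr => x xc; rewrite !linearZ_LR /= gh.
Qed.

End LinearExtension.


(** * Linear forms in general position *)

Section GenericForms.
Variables (R : realType) (d : nat).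

(** These forms trace the moment curve in the dual space. *)
Definition moment_form (t : R) (v : 'rV[R]_d) : R^o := (rVpoly v).[t].

Fact moment_form_linear t : linear (moment_form t).
Proof.
by move=> a u v; rewrite /moment_form linearP hornerD hornerZ.
Qed.

HB.instance Definition _ t :=
  GRing.isLinear.Build R 'rV[R]_d R^o *:%R (moment_form t) (moment_form_linear t).

(** A nonzero vector is the coefficient vector of a nonzero polynomial, so only
    finitely many points of the moment curve vanish on it. *)
Lemma form_avoiding (s : seq 'rV[R]_d) : (forall v, v \in s -> v != 0) ->
  exists f : 'Hom('rV[R]_d, R^o), forall v, v \in s -> f v != 0.
Proof.
move=> s0; pose p := \prod_(v <- s) rVpoly v.
have p0 : p != 0.
  rewrite prodf_seq_neq0; apply/allP => v /s0 v0 /=; apply: contraNneq v0 => pv.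
  by rewrite -[v]rVpolyK pv linear0.
have [t pt] : exists t, ~~ root p t.
  apply: contrapT => /forallNP all_root.
  pose rs := [seq i%:R : R | i <- iota 0 (size p)].
  have rs_root : all (root p) rs.
    by apply/allP => x _; apply: contrapT => /negP/all_root.
  have rs_uniq : uniq rs.
    by rewrite map_inj_uniq ?iota_uniq // => i j /eqP; rewrite eqr_nat => /eqP.
  by have := max_poly_roots p0 rs_root rs_uniq; rewrite size_map size_iota ltnn.
exists (linfun (moment_form t)) => v vs; rewrite lfunE /= /moment_form.
by move: pt; rewrite /root horner_prod prodf_seq_neq0 => /allP/(_ v vs).
Qed.

(** Forms in general position with respect to finitely many subspaces. Each new
    form is chosen not to vanish on a vector of what the previous ones leave of
    each subspace, so it cuts every remaining intersection by one dimension. *)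
Lemma generic_forms (I : finType) (U : I -> {vspace 'rV[R]_d}) :
  exists f : nat -> 'Hom('rV[R]_d, R^o), forall i v, v \in U i ->
    (forall j, (j < \dim (U i))%N -> f j v = 0) -> v = 0.
Proof.
pose K (f : nat -> 'Hom('rV[R]_d, R^o)) m := (\bigcap_(j < m) lker (f j))%VS.
have step n : exists f, forall m i, (m <= n)%N ->
    (\dim (U i :&: K f m) <= \dim (U i) - m)%N.
  elim: n => [|n [f fP]].
    exists (fun=> 0) => m i; rewrite leqn0 => /eqP->.
    by rewrite subn0 dimvS // capvSl.
  pose s := [seq v <- [seq vpick (U i :&: K f n)%VS | i : I] | v != 0].
  have [|g gP] := @form_avoiding s; first by move=> v; rewrite mem_filter => /andP[].
  exists (fun j => if j == n then g else f j) => m i le_m.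
  have EK l : (l <= n)%N -> K (fun j => if j == n then g else f j) l = K f l.
    move=> ln; apply: eq_bigr => j _.
    by rewrite ltn_eqF // (leq_trans (ltn_ord j)).
  move: le_m; rewrite leq_eqVlt => /predU1P[->|]; last by rewrite ltnS => ln; rewrite EK // fP.
  have -> : K (fun j => if j == n then g else f j) n.+1 = (K f n :&: lker g)%VS.
    by rewrite -EK // /K big_ord_recr /= eqxx.
  rewrite capvA.
  set W := (_ :&: K f n)%VS.
  have [W0|W0] := eqVneq W 0%VS; first by rewrite W0 cap0v dimv0.
  have := limg_ker_dim g W; have := fP n i (leqnn n); rewrite -/W => leW dimW.
  have : (0 < \dim (g @: W))%N.
    rewrite lt0n dimv_eq0; apply/negP => /eqP gW.
    have : g (vpick W) \in (g @: W)%VS by rewrite memv_img // memv_pick.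
    rewrite gW memv0; apply/negP; apply: gP; rewrite mem_filter vpick0 W0 /=.
    by apply/mapP; exists i; rewrite ?mem_enum.
  move: leW dimW; set a := \dim _; set b := \dim _; set c := \dim (_ :&: _); set e := \dim _.
  by clearbody a b c e; lia.
have [f fP] := step d; exists f => i v vU v0.
have le_d : (\dim (U i) <= d)%N by rewrite (leq_trans (dimvS (subvf _))) // dimvf /dim /= mul1n.
have := fP _ i le_d; rewrite subnn leqn0 dimv_eq0 => /eqP cap0.
apply/eqP; rewrite -memv0 -cap0 memv_cap vU /=.
rewrite /K; elim/big_rec: _ => [|j W _ IH]; first exact: memvf.
by rewrite memv_cap memv_ker v0 ?eqxx.
Qed.

End GenericForms.

(** * Faces and flats *)

Section Faces.
Variables (R : realType) (d : nat) (A : {fset {vspace 'rV[R]_d}}).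
Variable (L : labelling A).
Local Notation face := (face L).
Local Notation "x ** y" := (@mmul face x y) (at level 40, left associativity).
Implicit Types (x y z w : face) (S T X Y Z : {set A}) (H : A) (u v : 'rV[R]_d).

Definition hform H v : R := lform L H v.

Lemma hformD H u v : hform H (u + v) = hform H u + hform H v.
Proof. by rewrite /hform linearD. Qed.

Lemma hformZ H a v : hform H (a *: v) = a * hform H v.
Proof. by rewrite /hform linearZ. Qed.

Lemma hform_eq0 H v : (hform H v == 0) = (v \in val H).
Proof. exact: lform_eq0. Qed.

Definition sign_of (a : R) : sign :=
  if a == 0 then Zero else if 0 < a then Plus else Minus.

Lemma sign_of_eq0 a : (sign_of a == Zero) = (a == 0).
Proof.
rewrite /sign_of; case: ifP => _; first exact: eqxx.
by case: ifP => _; apply/negbTE/eqP.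
Qed.

Lemma sign_of0 : sign_of 0 = Zero.
Proof. by rewrite /sign_of eqxx. Qed.

Lemma sign_ofM c a : 0 < c -> sign_of (c * a) = sign_of a.
Proof. by move=> c0; rewrite /sign_of mulrI_eq0 ?pmulr_rgt0 //; apply/lregP; rewrite gt_eqF. Qed.

Lemma sign_of_gt0 a b : 0 < a -> 0 < b -> sign_of a = sign_of b.
Proof. by move=> a0 b0; rewrite /sign_of !gt_eqF // a0 b0. Qed.

Lemma sign_of_lt0 a b : a < 0 -> b < 0 -> sign_of a = sign_of b.
Proof. by move=> a0 b0; rewrite /sign_of !lt_eqF // ltNge ltW //= ltNge ltW. Qed.

Lemma sign_of_convex a b t s : sign_of a = sign_of b -> 0 < t -> 0 < s ->
  sign_of (t * a + s * b) = sign_of a.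
Proof.
move=> ab t0 s0; case: (ltgtP a 0) => [a0|a0|a0].
- have b0 : b < 0.
    by case: (ltgtP b 0) ab => // b0; rewrite /sign_of (lt_eqF a0) ltNge ltW //= ?b0 ?eqxx // gt_eqF.
  by apply: sign_of_lt0 => //; nra.
- have b0 : 0 < b.
    by case: (ltgtP b 0) ab => // b0; rewrite /sign_of (gt_eqF a0) a0 ?b0 ?eqxx // lt_eqF // ltNge ltW.
  by apply: sign_of_gt0 => //; nra.
have b0 : b = 0 by apply/eqP; rewrite -sign_of_eq0 -ab a0 sign_of0.
by rewrite a0 b0 !mulr0 addr0.
Qed.

Definition vsign v (H : A) := sign_of (hform H v).

Lemma vsign_halfspace v H s : halfspace L H s v <-> vsign v H = s.
Proof.
rewrite /vsign /sign_of; case: s; rewrite /halfspace /= -?hform_eq0 -?/(hform H v);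
  by case: (ltgtP (hform H v) 0).
Qed.

Lemma cell_vsign v : cell L (vsign v) v.
Proof. by move=> H _; apply/vsign_halfspace. Qed.

Definition face_of v : face :=
  Face (ex_intro _ v (cell_vsign v)) (ex_intro _ (vsign v) erefl).

Lemma face_ofE v H : face_sign (face_of v) H = sign_of (hform H v).
Proof. by rewrite (@face_signE _ _ _ _ _ (vsign v)). Qed.

Lemma face_of_surj x : exists v, face_of v = x.
Proof.
have [v xv] := face_neq0 x; exists v; apply: face_inj; apply/funext => H.
move: xv; rewrite face_ofE face_setE => /(_ H I).
by move/vsign_halfspace.
Qed.

Lemma face_signP x y : face_sign x =1 face_sign y -> x = y.
Proof. by move=> xy; apply: face_inj; apply/funext. Qed.

(** The flat spanned by x, recorded as the set of the hyperplanes containing it: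
    a larger set is a smaller flat. *)
Definition zs x : {set A} := [set H | face_sign x H == Zero].

Lemma in_zs x H : (H \in zs x) = (face_sign x H == Zero).
Proof. by rewrite inE. Qed.

Lemma in_zs_of v H : (H \in zs (face_of v)) = (hform H v == 0).
Proof. by rewrite inE face_ofE sign_of_eq0. Qed.

Lemma signM x y H :
  face_sign (x ** y) H = if H \in zs x then face_sign y H else face_sign x H.
Proof.
rewrite in_zs /mmul /= face_sign_mul /sign_prod /sign_mul.
by case: (face_sign x H) => /=; [case: eqP|case: eqP|rewrite eqxx].
Qed.

Lemma zsM x y : zs (x ** y) = zs x :&: zs y.
Proof.
apply/setP => H; rewrite finset.in_setI !in_zs signM in_zs.
by case: ifP => // /negbTE; case: eqP.
Qed.

Lemma mul_absorb x y : zs x \subset zs y -> (x ** y) = x.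
Proof.
move=> /fintype.subsetP xy; apply: face_signP => H; rewrite signM.
by case: ifP => // Hx; move: Hx (xy _ Hx); rewrite !in_zs => /eqP-> /eqP->.
Qed.

Lemma zs1 : zs (mone : face) = [set: A].
Proof. by apply/setP => H; rewrite !inE /mone /= face_sign_one eqxx. Qed.

Definition flat S : bool := `[< exists x, zs x = S >].

Lemma flatP S : reflect (exists x, zs x = S) (flat S).
Proof. exact: asboolP. Qed.

Lemma flat_zs x : flat (zs x).
Proof. by apply/flatP; exists x. Qed.

Definition fspan S : {vspace 'rV[R]_d} := (\bigcap_(H in S) val H)%VS.

Lemma fspanP S v : reflect (forall H, H \in S -> hform H v = 0) (v \in fspan S).
Proof.
apply: (iffP idP) => [vS H HS|v0].
  have sub : (fspan S <= val H)%VS by rewrite /fspan (bigD1 H) //= capvSl.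
  by apply/eqP; rewrite hform_eq0; apply: (subvP sub).
rewrite /fspan; elim/big_rec: _ => [|H W HS IH]; first exact: memvf.
by rewrite memv_cap IH andbT -hform_eq0 v0.
Qed.

Lemma fspan_zs S v : (v \in fspan S) = (S \subset zs (face_of v)).
Proof.
apply/fspanP/fintype.subsetP => h H /h; first by rewrite in_zs_of => ->.
by rewrite in_zs_of => /eqP.
Qed.

Lemma fspanS S T : S \subset T -> (fspan T <= fspan S)%VS.
Proof.
move=> ST; apply/subvP => v; rewrite !fspan_zs; exact: fintype.subset_trans.
Qed.

Definition fdim S := \dim (fspan S).

Lemma fdimS S T : S \subset T -> (fdim T <= fdim S)%N.
Proof. by move=> ST; apply/dimvS/fspanS. Qed.

(** A face that spans S has a point lying on no hyperplane outside S. *)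
Lemma flat_span S T : flat S -> (fspan S <= fspan T)%VS -> T \subset S.
Proof.
move=> /flatP[x <-] /subvP ST; have [v vx] := face_of_surj x.
by move: (ST v); rewrite !fspan_zs vx fintype.subxx => /(_ isT).
Qed.

(** If the dimensions agreed, the two spans would agree, and a flat is recovered
    from its span. *)
Lemma fdim_proper S T : flat S -> S \proper T -> (fdim T < fdim S)%N.
Proof.
move=> fS /andP[ST TS]; rewrite ltn_neqAle fdimS // andbT.
apply: contra TS => /eqP eq_dim; apply: flat_span => //.
by have /dimv_leqif_eq := fspanS ST; rewrite -/(fdim _) eq_dim => [[_]]; rewrite eqxx => /esym/eqP->.
Qed.

Lemma fdim_eq S T : flat S -> S \subset T -> fdim S = fdim T -> S = T.
Proof.
move=> fS ST eq_dim; apply/eqP; rewrite eqEproper ST /=.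
by apply/negP => /fdim_proper-/(_ fS); rewrite eq_dim ltnn.
Qed.

Lemma fdim_le_d S : (fdim S <= d)%N.
Proof. by rewrite (leq_trans (dimvS (subvf _))) // dimvf /dim /= mul1n. Qed.

End Faces.

(** * Generic directions in flats *)

Section Directions.
Variables (R : realType) (d : nat) (A : {fset {vspace 'rV[R]_d}}).
Variable (L : labelling A).
Local Notation face := (face L).
Local Notation "x ** y" := (@mmul face x y) (at level 40, left associativity).
Implicit Types (x y z : face) (S T X Y Z : {set A}) (H : A) (v : 'rV[R]_d).

Lemma homZ (f : 'Hom('rV[R]_d, R^o)) (a : R) v : f (a *: v) = a * f v :> R.
Proof. by rewrite linearZ. Qed.

Lemma dim_cap_lker (f : nat -> 'Hom('rV[R]_d, R^o)) (V : {vspace 'rV[R]_d}) n :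
  (\dim V <= \dim (V :&: \bigcap_(j < n) lker (f j)) + n)%N.
Proof.
elim: n => [|n IH]; first by rewrite big_ord0 capvf addn0.
rewrite big_ord_recr /= capvA; move: IH; set W := (V :&: _)%VS.
have := limg_ker_dim (f n) W.
have : (\dim (f n @: W) <= 1)%N by rewrite (leq_trans (dimvS (subvf _))) // dimvf.
set a := \dim _; set b := \dim _; set c := \dim _; set e := \dim _.
by clearbody a b c e; lia.
Qed.

(** A coherent orientation of all flats. Given forms f_0, f_1, ... in general
    position, take u S on the line of fspan S where f_j vanishes for all
    j < fdim S - 1, normalised by f_j = 1 for j = fdim S - 1. If T has dimension
    one more than Y, the vectors of fspan T on which f_j is 0 for j < fdim Y - 1
    and 1 for j = fdim Y - 1 form the affine line through u Y with direction u T.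
    That line contains u Y' for each Y' of the same dimension inside T, and it
    misses every span of dimension smaller than that of Y. *)
Record generic_directions (u : {set A} -> 'rV[R]_d) : Prop := GenericDirections {
  dir_span : forall S, (0 < fdim S)%N -> u S \in fspan S;
  dir_proper : forall S T, (0 < fdim S)%N -> u S \in fspan T ->
    (fdim S <= fdim T)%N;
  dir_line : forall T Y Y', T \subset Y -> T \subset Y' -> (0 < fdim Y)%N ->
    fdim T = (fdim Y).+1 -> fdim Y' = fdim Y ->
    exists t, u Y' = u Y + t *: u T;
  dir_line_proper : forall T Y S t, (0 < fdim Y)%N -> fdim T = (fdim Y).+1 ->
    u Y + t *: u T \in fspan S -> (fdim Y <= fdim S)%N }.

Lemma generic_directions_ex : exists u, generic_directions u.
Proof.
have [f gen] := generic_forms (fun S : {set A} => fspan S).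
have uniq_in S v w : v \in fspan S -> w \in fspan S ->
    (forall j, (j < fdim S)%N -> f j v = f j w) -> v = w.
  move=> vS wS vw; apply/eqP; rewrite -subr_eq0; apply/eqP; apply: (gen S).
    exact: memvB.
  by move=> j jS; rewrite linearB /= vw // subrr.
have ex S : exists u, (0 < fdim S)%N -> [/\ u \in fspan S,
    forall j, (j < (fdim S).-1)%N -> f j u = 0 & f (fdim S).-1 u = 1].
  case: (posnP (fdim S)) => [->|S0]; first by exists 0.
  have := dim_cap_lker f (fspan S) (fdim S).-1; set W := (_ :&: _)%VS => leW.
  have /memv_capP[vS vK] : vpick W \in W by apply: memv_pick.
  have v0 : vpick W != 0.
    by rewrite vpick0 -dimv_eq0; move: leW S0; rewrite -/(fdim S); lia.
  have vj j : (j < (fdim S).-1)%N -> f j (vpick W) = 0.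
    move=> jS; apply/eqP; rewrite -memv_ker; move: vK; apply/subvP.
    by rewrite (bigD1 (Ordinal jS)) //= capvSl.
  have vn : f (fdim S).-1 (vpick W) != 0.
    apply: contraNneq v0 => vn; apply/eqP; apply: gen vS _ => j.
    rewrite -/(fdim S) -(prednK S0) ltnS leq_eqVlt => /predU1P[->//|]; exact: vj.
  exists ((f (fdim S).-1 (vpick W))^-1 *: vpick W) => _; split.
  - exact: memvZ.
  - by move=> j jS; rewrite homZ (vj j jS) mulr0.
  by rewrite homZ mulVf.
have [u uP] := choice ex.
exists u; split.
- by move=> S /uP[].
- move=> S T /[dup] S0 /uP[_ uj u1] uT; rewrite leqNgt; apply/negP => TS.
  have u0 : u S = 0.
    by apply: gen uT _ => j jT; apply: uj; move: jT TS; rewrite -/(fdim T); lia.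
  by move: u1; rewrite u0 linear0 => /esym/eqP; rewrite oner_eq0.
- move=> T Y Y' TY TY' Y0 dT dY.
  have [uYs uYj uY1] := uP Y Y0.
  have [|uYs' uYj' uY1'] := uP Y'; first by rewrite dY.
  have [|uTs uTj uT1] := uP T; first by rewrite dT.
  move: uTj uT1; rewrite dT /= => uTj uT1; move: uYj' uY1'; rewrite dY => uYj' uY1'.
  exists (f (fdim Y) (u Y' - u Y)); apply/eqP; rewrite addrC -subr_eq; apply/eqP.
  apply: (uniq_in T).
  - by rewrite memvB // ?(subvP (fspanS L TY) _ uYs) ?(subvP (fspanS L TY') _ uYs').
  - exact: memvZ.
  move=> j; rewrite dT ltnS leq_eqVlt => /predU1P[->|jY].
    by rewrite [RHS]homZ uT1 mulr1.
  rewrite [RHS]homZ uTj // mulr0 linearB /=.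
  move: jY; rewrite -(prednK Y0) ltnS leq_eqVlt => /predU1P[->|jY].
    by rewrite uY1 uY1' subrr.
  by rewrite uYj ?uYj' // subrr.
move=> T Y S t Y0 dT uS; rewrite leqNgt; apply/negP => SY.
  have [uYs uYj uY1] := uP Y Y0; have [|uTs uTj uT1] := uP T; first by rewrite dT.
  move: uTj uT1; rewrite dT /= => uTj uT1.
  have u0 : u Y + t *: u T = 0.
    apply: gen uS _ => j jT; rewrite linearD /= homZ uTj ?uYj ?mulr0 ?addr0 //;
      by move: jT SY; rewrite -/(fdim S); lia.
  have := congr1 (f (fdim Y).-1) u0.
  rewrite linearD /= homZ uY1 uTj ?mulr0 ?addr0 ?linear0; last by lia.
  by move/eqP; rewrite oner_eq0.
Qed.

Variables (u : {set A} -> 'rV[R]_d) (uP : generic_directions u).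

Lemma zs_dir S : flat L S -> (0 < fdim S)%N -> zs (face_of L (u S)) = S.
Proof.
move=> fS S0; apply/esym/eqP; rewrite eqEproper -fspan_zs (dir_span uP) //=.
apply/negP => /(fdim_proper fS); rewrite ltnNge (dir_proper uP) //.
by rewrite (fspan_zs L) fintype.subxx.
Qed.

End Directions.

(** * Step functions on a line *)

Section Telescope.
Variables (R : realFieldType) (V : zmodType) (I : finType) (P : pred I).
Variables (t : I -> R) (G : R -> V) (gp gm : I -> V).
Hypothesis t_inj : {in P &, injective t}.
Hypothesis G_const : forall a b, a <= b ->
  (forall j, P j -> t j < a \/ b < t j) -> G a = G b.
Hypothesis G_right : forall i b, P i -> t i < b ->
  (forall j, P j -> t j <= t i \/ b < t j) -> G b = gp i.
Hypothesis G_left : forall i a, P i -> a < t i ->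
  (forall j, P j -> t i <= t j \/ t j < a) -> G a = gm i.

Lemma lt_all_between (a : R) (s : seq R) : (forall x, x \in s -> a < x) ->
  exists2 c, a < c & forall x, x \in s -> c < x.
Proof.
elim: s => [|y s IH] lta; first by exists (a + 1) => //; rewrite ltrDl.
have [x xs|c ac lec] := IH; first by rewrite lta // inE xs orbT.
have ay : a < y by rewrite lta ?mem_head.
exists ((a + Num.min c y) / 2).
  by case: (leP c y) => _; lra.
move=> x; rewrite inE => /predU1P[->|/lec cx].
  by case: (leP c y) => ?; lra.
by case: (leP c y) => ?; lra.
Qed.

(** G is a step function: on either side of t i it takes the values gm i and
    gp i, so the jumps add up to its total increment. *)
Lemma telescope a b : a <= b -> (forall i, P i -> a < t i < b) ->
  \sum_(i | P i) (gp i - gm i) = G b - G a.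
Proof.
move=> ab ltab.
(* Q holds the points to the right of a; the others have been passed. *)
suff aux n (Q : {set I}) : forall a, #|Q| = n -> a <= b -> {subset Q <= P} ->
    (forall i, P i -> i \in Q \/ t i < a) -> {in Q, forall i, a < t i < b} ->
    \sum_(i in Q) (gp i - gm i) = G b - G a.
  have -> : \sum_(i | P i) (gp i - gm i) = \sum_(i in [set i | P i]) (gp i - gm i).
    by apply: eq_bigl => i; rewrite inE.
  apply: aux erefl _ _ _ _ => // [i|i|i]; rewrite inE //; first by left.
  exact: ltab.
elim: n Q => [|n IH] Q {ab ltab}a Qn ab QP ltQ inQ.
  move/eqP: Qn; rewrite cards_eq0 => /eqP Q0.
  rewrite {1}Q0 big_set0 (G_const ab) ?subrr // => j /ltQ[]; first by rewrite Q0 inE.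
  by left.
have /card_gt0P[i0 Qi0] : (0 < #|Q|)%N by rewrite Qn.
case: (Order.TotalTheory.arg_minP t Qi0) => i iQ mini; have Qi : i \in Q := iQ; pose Q' := Q :\ i.
have t_lt j : j \in Q' -> t i < t j.
  rewrite !inE => /andP[ji Qj]; rewrite lt_neqAle mini // andbT.
  by apply: contraNneq ji => tij; apply/eqP/esym/t_inj => //; apply: QP.
have /andP[at_i t_ib] := inQ i Qi.
have [|c ic cQ] := @lt_all_between (t i) (b :: [seq t j | j in Q']).
  move=> x; rewrite inE => /predU1P[->//|/fintype.imageP[j Qj ->]]; exact: t_lt.
have cb : c < b by apply: cQ; rewrite mem_head.
have cQ' j : j \in Q' -> c < t j.
  by move=> Qj; apply: cQ; rewrite inE; apply/orP; right; apply/fintype.imageP; exists j.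
have Pi : P i := QP _ Qi.
have cases j : P j -> [\/ j = i, j \in Q' | t j < a].
  move=> /ltQ[Qj|]; last by constructor 3.
  by have [->|ji] := eqVneq j i; [constructor 1 | constructor 2; rewrite !inE ji].
rewrite (big_setD1 i) //= (IH _ c).
- have -> : G c = gp i.
    apply: G_right => // j /cases[->|/cQ'|ja]; [by left|by right|left].
    by rewrite ltW // (lt_trans ja).
  have -> : G a = gm i.
    apply: G_left => // j /cases[->|/t_lt/ltW|]; [by left|by left|by right].
  by rewrite addrC addrA subrK.
- by move: Qn; rewrite (cardsD1 i) Qi => [[]].
- exact: ltW.
- by move=> j; rewrite !inE => /andP[_ /QP].
- move=> j /cases[->|?|ja]; [by right|by left|right].
  by rewrite (lt_trans ja) // (lt_trans at_i).
by move=> j Qj; rewrite cQ' //=; move: Qj; rewrite !inE => /andP[_ /inQ/andP[]].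
Qed.

End Telescope.

(** * Flats in a pencil *)

Section Pencil.
Variables (R : realType) (d : nat) (A : {fset {vspace 'rV[R]_d}}).
Variable (L : labelling A).
Local Notation face := (face L).
Local Notation "x ** y" := (@mmul face x y) (at level 40, left associativity).
Implicit Types (x y z : face) (S T X Y Z : {set A}) (H : A) (v : 'rV[R]_d).

Variables (u : {set A} -> 'rV[R]_d) (uP : generic_directions u).

Definition dirface (e : R) Y : face := face_of L (e *: u Y).

Lemma zs_dirface e Y : e != 0 -> flat L Y -> (0 < fdim Y)%N -> zs (dirface e Y) = Y.
Proof.
move=> e0 fY Y0; rewrite -[RHS](zs_dir uP fY Y0); apply/setP => H.
by rewrite !in_zs_of hformZ mulf_eq0 (negbTE e0).
Qed.

Lemma sign_of_scale (p q h : R) : 0 < p * q -> sign_of (p * h) = sign_of (q * h).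
Proof.
move=> pq; have q0 : q != 0 by apply: contraTneq pq => ->; rewrite mulr0 ltxx.
have -> : p * h = p / q * (q * h) by rewrite mulrA divfK.
apply: sign_ofM; have -> : p / q = p * q / q ^+ 2 by field.
by rewrite divr_gt0 // exprn_even_gt0.
Qed.

Definition covers X Y := [&& flat L Y, Y \subset X & fdim Y == (fdim X).+1].

Section OnePencil.
Variables (V : zmodType) (g : face -> V) (x : face) (T : {set A}) (e : R).
Hypothesis e0 : e != 0.
Hypothesis fT : flat L T.
Hypothesis TX : T \subset zs x.
Hypothesis dT : fdim T = (fdim (zs x)).+2.

Let between Y := covers (zs x) Y && (T \subset Y).

(** The affine line e u(Y0) + R u(T) meets the hyperplanes of zs x outside T
    exactly in the points e u(Y), where Y runs over the flats between the flat of
    x and T. Multiplying x by the face of a point of the line gives a step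
    function, with jumps at these points. Next to the jump at Y its values are
    the two summands, and far out they are the two terms on the right. *)
Lemma pencil Y0 : between Y0 ->
  \sum_(Y | between Y) (g (x ** dirface e Y ** dirface 1 T) -
                        g (x ** dirface e Y ** dirface (-1) T)) =
  g (x ** dirface 1 T) - g (x ** dirface (-1) T).
Proof.
move=> /andP[/and3P[fY0 Y0X /eqP dY0] TY0].
have Y0_gt0 : (0 < fdim Y0)%N by rewrite dY0.
have T_gt0 : (0 < fdim T)%N by rewrite dT.
have [tau tauP] : exists tau : {set A} -> R,
    forall Y, between Y -> u Y = u Y0 + tau Y *: u T.
  suff /choice[tau tauP] Y : exists t, between Y -> u Y = u Y0 + t *: u T.
    by exists tau.
  case: (boolP (between Y)) => [|_]; last by exists 0.
  move=> /andP[/and3P[fY YX /eqP dY] TY].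
  have [||t ->] := dir_line uP TY0 TY Y0_gt0; rewrite ?dY0 ?dT //; by exists t.
pose h H := hform L H (u T); pose a H := hform L H (u Y0).
pose r H := - (e * a H) / h H.
pose line t := e *: u Y0 + t *: u T.
have h0 H : (h H == 0) = (H \in T) by rewrite -in_zs_of (zs_dir uP).
have a0 H : H \in T -> a H = 0.
  by move=> /(fintype.subsetP TY0); rewrite -{1}(zs_dir uP fY0 Y0_gt0) in_zs_of => /eqP.
(* The line crosses H at the parameter r H. *)
have lineE t H : hform L H (line t) = (t - r H) * h H.
  rewrite hformD !hformZ -/(a H) -/(h H) /r.
  have [hH|hH] := eqVneq (h H) 0; last by field.
  by rewrite hH a0 ?mulr0 ?addr0 // -h0 hH.
have line_tau Y : between Y -> line (e * tau Y) = e *: u Y.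
  by move=> /tauP->; rewrite /line scalerDr scalerA.
(* The crossing point of H spans, together with x, a flat between that of x and
   T: it is too generic to lie in the flat of x. *)
have root H : H \in zs x -> H \notin T -> exists2 Y, between Y & e * tau Y = r H.
  move=> HX HT; have hH : h H != 0 by rewrite h0.
  pose v := u Y0 + (- a H / h H) *: u T.
  have v0 : hform L H v = 0 by rewrite hformD hformZ -/(a H) -/(h H) divfK ?subrr.
  pose Y := zs (x ** face_of L v).
  have YE : Y = zs x :&: zs (face_of L v) by rewrite /Y zsM.
  have TY : T \subset Y.
    rewrite YE finset.subsetI TX -fspan_zs rpredD ?rpredZ ?(dir_span uP) //.
    exact: subvP (fspanS L TY0) _ (dir_span uP Y0_gt0).
  have HY : H \in Y by rewrite YE inE HX in_zs_of v0 eqxx.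
  have leY : (fdim Y0 <= fdim Y)%N.
    apply: (dir_line_proper uP (T := T) (t := - a H / h H)) => //; first by rewrite dT dY0.
    by rewrite (fspan_zs L) YE finset.subsetIr.
  have ltY : (fdim Y < fdim T)%N.
    apply: fdim_proper fT _; rewrite properE TY /=; apply: contra HT => /fintype.subsetP; exact.
  have bY : between Y.
    rewrite /between /covers TY flat_zs YE finset.subsetIl /= -YE andbT eqn_leq.
    by rewrite -ltnS -dT ltY -dY0 leY.
  exists Y => //; have := lineE (e * tau Y) H.
  rewrite line_tau // hformZ.
  have -> : hform L H (u Y) = 0.
    have : H \in zs (face_of L (u Y)) by rewrite (zs_dir uP) ?flat_zs //; case/andP: bY => /and3P[_ _ /eqP->].
    by rewrite in_zs_of => /eqP.
  move/esym/eqP; rewrite mulr0 mulf_eq0 (negbTE hH) orbF subr_eq0 => /eqP //.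
have root_cases H : H \in zs x -> h H = 0 \/ exists2 Y, between Y & e * tau Y = r H.
  move=> HX; case: (boolP (H \in T)) => HT; last by right; apply: root.
  by left; apply/eqP; rewrite h0.
pose F t := x ** face_of L (line t).
have F_eq t y : (forall H, H \notin zs x -> face_sign y H = face_sign x H) ->
    (forall H, H \in zs x -> face_sign y H = sign_of ((t - r H) * h H)) -> F t = y.
  move=> yx ysgn; apply: face_signP => H; rewrite signM face_ofE lineE.
  by case: ifP => [/ysgn->//|/negbT/yx->].
have F_dir t e' : (forall H, H \in zs x -> h H = 0 \/ 0 < (t - r H) * e') ->
    F t = x ** dirface e' T.
  move=> te; apply: F_eq => H Hx; rewrite signM ?(negbTE Hx) // Hx face_ofE hformZ -/(h H).
  by case: (te H Hx) => [->|/sign_of_scale->] //; rewrite !mulr0.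
have F_dir2 t Y e' : between Y ->
    (forall H, H \in zs x -> [\/ h H = 0,
       (e * tau Y = r H /\ 0 < (t - r H) * e') |
       0 < (t - r H) * (e * tau Y - r H)]) ->
    F t = x ** dirface e Y ** dirface e' T.
  move=> bY te; have := bY => /andP[/and3P[fY YX /eqP dY] TY].
  have zY : zs (x ** dirface e Y) = Y.
    by rewrite zsM zs_dirface ?dY //; apply/finset.setIidPr.
  have signY H : hform L H (e *: u Y) = (e * tau Y - r H) * h H.
    by rewrite -line_tau // lineE.
  have inY H : (H \in Y) = ((e * tau Y - r H) * h H == 0).
    by rewrite -signY -{1}(@zs_dirface e Y) ?dY // in_zs_of.
  apply: F_eq => H Hx; rewrite signM zY.
    have /negbTE-> : H \notin Y by apply: contra Hx => /(fintype.subsetP YX).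
    by rewrite signM (negbTE Hx).
  rewrite signM Hx !face_ofE hformZ -/(h H) signY inY mulf_eq0.
  case: (te H Hx) => [->|[<- te']|te'].
  - by rewrite eqxx orbT !mulr0.
  - by rewrite subrr eqxx (sign_of_scale _ te').
  have /negbTE-> : e * tau Y - r H != 0 by apply: contraTneq te' => ->; rewrite mulr0 ltxx.
  case: eqP => [->|_] /=; first by rewrite !mulr0.
  by rewrite (sign_of_scale _ te').
have tau_inj : {in between &, injective (fun Y => e * tau Y)}.
  move=> Y Y' bY bY' /(mulfI e0) tt.
  have zsu Z : between Z -> zs (face_of L (u Z)) = Z.
    by move=> /andP[/and3P[fZ _ /eqP dZ] _]; rewrite (zs_dir uP) // dZ.
  by rewrite -[Y]zsu // -[Y']zsu // (tauP Y) // (tauP Y') // tt.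
have [b ltb] : exists b, forall Y, e * tau Y < b /\ - (e * tau Y) < b.
  exists (1 + \sum_Y `|e * tau Y|) => Y.
  have : `|e * tau Y| <= \sum_Y `|e * tau Y| by rewrite (bigD1 Y) //= lerDl sumr_ge0.
  by have := ler_norm (e * tau Y); have := ler_norm (- (e * tau Y)); rewrite normrN; lra.
have b0 : 0 < b by have [] := ltb Y0; lra.
rewrite -(F_dir b) => [|H /root_cases[->|[Y bY <-]]]; [|by left|right]; last first.
  by rewrite mulr1; have [] := ltb Y; lra.
rewrite -(F_dir (- b)) => [|H /root_cases[->|[Y bY <-]]]; [|by left|right]; last first.
  by have [] := ltb Y; lra.
apply: (telescope (t := fun Y => e * tau Y) (G := fun t => g (F t))) => //.
- move=> s t st out; congr g; apply: F_eq => H Hx; rewrite signM ?(negbTE Hx) //.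
  rewrite Hx face_ofE lineE.
  have [->|[Y bY rY]] := root_cases H Hx; first by rewrite !mulr0.
  apply: sign_of_scale; have := out Y bY; rewrite rY.
  case=> ?; last by rewrite -mulrNN mulr_gt0 //; lra.
  by rewrite mulr_gt0 //; lra.
- move=> Y t bY tY out; congr g; apply: F_dir2 => // H Hx.
  have [->|[Y' bY' rY]] := root_cases H Hx; first by constructor 1.
  rewrite -rY; move: tY (out Y' bY'); move: (e * tau Y) (e * tau Y') => p q tp.
  case=> [|tq]; last by constructor 3; nra.
  by rewrite le_eqVlt => /predU1P[->|?]; [constructor 2; split=> //; nra | constructor 3;
  rewrite mulr_gt0 //; lra].
- move=> Y t bY tY out; congr g; apply: F_dir2 => // H Hx.
  have [->|[Y' bY' rY]] := root_cases H Hx; first by constructor 1.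
  rewrite -rY; move: tY (out Y' bY'); move: (e * tau Y) (e * tau Y') => p q tp.
  case=> [|tq]; last by constructor 3; nra.
  by rewrite le_eqVlt => /predU1P[<-|?]; [constructor 2; split=> //; nra | constructor 3;
  rewrite -mulrNN mulr_gt0 //; lra].
- lra.
by move=> Y bY; have [] := ltb Y; lra.
Qed.
End OnePencil.
End Pencil.

(** * The face modules and the boundary map *)

Lemma malg_ind (k : fieldType) (K : choiceType) (P : {malg k[K]} -> Prop) :
  P 0 -> (forall a x c, P c -> P (a *: << x >> + c)) -> forall c, P c.
Proof.
by move=> P0 PD c; rewrite [c]malg_sum; elim/big_rec: _ => // x c' _; apply: PD.
Qed.

Lemma scaler_swap (k : fieldType) (V : lmodType k) (a b : k) (x y z t : V) :
  a *: (b *: x + y) + (b *: z + t) = b *: (a *: x + z) + (a *: y + t).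
Proof. by rewrite !scalerDr !scalerA [a * b]mulrC addrACA. Qed.

Lemma sumrB_eq0 (V : zmodType) (I : finType) (P : pred I) (F G : I -> V) (c : V) :
  \sum_(i | P i) F i = c -> \sum_(i | P i) G i = c -> \sum_(i | P i) (F i - G i) = 0.
Proof. by move=> Fc Gc; rewrite sumrB Fc Gc subrr. Qed.

Section Boundary.
Variables (R : realType) (d : nat) (A : {fset {vspace 'rV[R]_d}}).
Variables (L : labelling A) (k : fieldType).
Local Notation face := (face L).
Local Notation chain := {malg k[face]}.
Local Notation alg := (face_algebra L k).
Local Notation "x ** y" := (@mmul face x y) (at level 40, left associativity).
Implicit Types (x y z w : face) (S T X Y Z : {set A}) (H : A) (c m : chain).

(** The associated graded of left multiplication for the filtration of the face
    algebra by flats: a product that leaves the flat of x is dropped. *)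
Definition trunc w x : chain := if zs x \subset zs w then << w ** x >> else 0.

Definition act1 w : chain -> chain := lin (trunc w).

Definition act (a : alg) (m : chain) : chain := lin (act1^~ m) a.

Lemma alg_ind (P : alg -> Prop) : P 0 ->
  (forall (e : k) w (a : alg), P a -> P (e *: (<< w >> : alg) + a)) -> forall a, P a.
Proof. by move=> P0 PD; apply: malg_ind. Qed.

Lemma act1U w x : act1 w << x >> = trunc w x.
Proof. exact: linU. Qed.

Lemma act1P w (e : k) m m' : act1 w (e *: m + m') = e *: act1 w m + act1 w m'.
Proof. exact: linP. Qed.

Lemma act10 w : act1 w 0 = 0.
Proof. exact: lin0. Qed.

Lemma actU w m : act << w >> m = act1 w m.
Proof. exact: linU. Qed.

Lemma act_linear_l m : linear (act^~ m : alg -> chain).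
Proof. by move=> c a b; rewrite /act linearP. Qed.

Lemma act0 m : act 0 m = 0.
Proof. by rewrite /act linear0. Qed.

Lemma act_linear_r a : linear (act a).
Proof.
move=> c m m'; elim/alg_ind: a => [|e w a IH]; first by rewrite !act0 scaler0 addr0.
rewrite !act_linear_l IH !actU act1P.
by apply: scaler_swap.
Qed.

Lemma algUM w w' : (<< w >> * << w' >> : alg) = << w ** w' >>.
Proof. by rewrite [LHS]fgmulUU mulr1. Qed.

Lemma truncM w w' x : act1 w (trunc w' x) = trunc (w ** w') x.
Proof.
rewrite /trunc zsM finset.subsetI; case: ifP => xw'; last by rewrite act10 andbF.
rewrite act1U /trunc zsM.
by rewrite andbT (finset.setIidPr xw') mulmA.
Qed.

Lemma actP (e : k) (a b : alg) m : act (e *: a + b) m = e *: act a m + act b m.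
Proof. exact: act_linear_l. Qed.

Lemma actPr a (e : k) m m' : act a (e *: m + m') = e *: act a m + act a m'.
Proof. exact: act_linear_r. Qed.

Lemma act1A w w' m : act1 w (act1 w' m) = act1 (w ** w') m.
Proof.
elim/malg_ind: m => [|g x m IH]; first by rewrite !act10.
by rewrite !act1P IH !act1U truncM.
Qed.

Lemma actA1 w b m : act1 w (act b m) = act ((<< w >> : alg) * b) m.
Proof.
elim/alg_ind: b => [|f w' b IH]; first by rewrite mulr0 !act0 act10.
by rewrite mulrDr -scalerAr algUM actP actP act1P IH !actU act1A.
Qed.

Lemma actA a b m : act a (act b m) = act (a * b) m.
Proof.
elim/alg_ind: a => [|e w a IH]; first by rewrite mul0r !act0.
by rewrite mulrDl -scalerAl actP actP IH actU actA1.
Qed.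

Lemma act_one m : act 1 m = m.
Proof.
rewrite [act _ _]actU; elim/malg_ind: m => [|g x m IH]; first by rewrite act10.
by rewrite act1P IH act1U /trunc zs1 finset.subsetT mul1m.
Qed.

Lemma act_scale (e : k) a m : act (e *: a) m = e *: act a m.
Proof. by have := actP e a 0 m; rewrite !addr0 act0 addr0. Qed.

Lemma actDl m : {morph act^~ m : a b / a + b}.
Proof. by move=> a b; have := actP 1 a b m; rewrite !scale1r. Qed.

Lemma actDr : right_distributive act +%R.
Proof. by move=> a m m'; have := actPr a 1 m m'; rewrite !scale1r. Qed.

Definition truncated : Type := chain.
HB.instance Definition _ := GRing.Zmodule.on truncated.
HB.instance Definition _ := GRing.Zmodule_isLmodule.Build alg truncated
  actA act_one actDr actDl.

Variables (u : {set A} -> 'rV[R]_d) (uP : generic_directions u).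
Local Notation dirface := (dirface L u).

(** The two faces of Y adjacent to x lie on opposite sides of x in Y; the
    direction u Y says which one counts positively. *)
Definition step x Y : chain := << x ** dirface 1 Y >> - << x ** dirface (-1) Y >>.

(** For a fixed flat Z this is the cellular boundary map of the zonotope dual to
    the arrangement that the hyperplanes induce in Z. *)
Definition bdry1 Z x : chain := \sum_(Y | covers L (zs x) Y && (Z \subset Y)) step x Y.

Definition bdry Z : chain -> chain := lin (bdry1 Z).

Lemma bdryP Z (e : k) c c' : bdry Z (e *: c + c') = e *: bdry Z c + bdry Z c'.
Proof. exact: linP. Qed.

Lemma bdry0 Z : bdry Z 0 = 0.
Proof. exact: lin0. Qed.

Lemma bdryB Z c c' : bdry Z (c - c') = bdry Z c - bdry Z c'.
Proof. exact: linB. Qed.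

Lemma bdry_sum Z (I : Type) (r : seq I) (P : pred I) (F : I -> chain) :
  bdry Z (\sum_(i <- r | P i) F i) = \sum_(i <- r | P i) bdry Z (F i).
Proof. exact: lin_sum. Qed.

Lemma bdryU Z x : bdry Z << x >> = bdry1 Z x.
Proof. exact: linU. Qed.

Lemma zs_covers e x Y : e != 0 -> covers L (zs x) Y -> zs (x ** dirface e Y) = Y.
Proof.
move=> e0 /and3P[fY Yx /eqP dY]; rewrite zsM (zs_dirface uP) ?dY //.
exact/finset.setIidPr.
Qed.

Lemma neg1_neq0 : (-1 : R) != 0.
Proof. by rewrite oppr_eq0 oner_eq0. Qed.

(** Group the terms by the final flat T. For fixed T, either sign of the first
    step contributes the same telescoping sum [step x T], by [pencil]. *)
Lemma bdry_sq Z c : bdry Z (bdry Z c) = 0.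
Proof.
elim/malg_ind: c => [|e x c IH]; first by rewrite !bdry0.
rewrite !bdryP IH addr0 bdryU /bdry1 bdry_sum.
have cov e' Y : e' != 0 -> covers L (zs x) Y ->
    bdry Z << x ** dirface e' Y >> =
    \sum_(T | covers L Y T && (Z \subset T)) step (x ** dirface e' Y) T.
  by move=> e'0 cY; rewrite bdryU /bdry1 zs_covers.
under eq_bigr => Y /andP[cY _] do
  rewrite bdryB !cov ?neg1_neq0 ?oner_eq0 // -sumrB.
rewrite (exchange_big_dep predT) // big1 ?scaler0 // => T _.
case: (pickP [pred Y | covers L (zs x) Y && (Z \subset Y) && (covers L Y T && (Z \subset T))]);
  last by move=> no; rewrite big_pred0.
move=> Y0 /= /andP[/andP[cY0 ZY0] /andP[cT ZT]].
have /and3P[fY0 Y0x /eqP dY0] := cY0; have /and3P[fT TY0 /eqP dT] := cT.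
have TX : T \subset zs x := fintype.subset_trans TY0 Y0x.
rewrite (eq_bigl (fun Y => covers L (zs x) Y && (T \subset Y))); last first.
  move=> Y; rewrite ZT andbT /covers fT dT dY0.
  case: (flat L Y) => //=; case: (Y \subset _) => //=.
  have [dY|] //= := eqVneq (fdim Y) _; rewrite dY eqxx andbT.
  case: (boolP (T \subset Y)) => // TY; last by rewrite andbF.
  by rewrite (fintype.subset_trans ZT TY).
have between0 : covers L (zs x) Y0 && (T \subset Y0) by rewrite cY0.
rewrite dY0 in dT.
have pen e' : e' != 0 ->
    \sum_(Y | covers L (zs x) Y && (T \subset Y)) step (x ** dirface e' Y) T = step x T.
  by move=> e'0; apply: (pencil uP (fun y => << y >> : chain) e'0 fT TX dT between0).
exact: (@sumrB_eq0 chain _ _ _ _ _ (pen 1 (oner_neq0 _)) (pen (-1) neg1_neq0)).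
Qed.

(** If w leaves the flat of x but lies in Y, then w x spans Y, so both adjacent
    faces are absorbed and the two terms of [step x Y] cancel. *)
Lemma act_bdry1 Z w x : act1 w (bdry1 Z x) = bdry Z (trunc w x).
Proof.
rewrite /trunc; case: ifP => [xw|/negbT xw].
  rewrite bdryU /bdry1 [act1 _ _]lin_sum zsM (finset.setIidPr xw).
  apply: eq_bigr => Y /andP[cY ZY]; rewrite [lin _ _]linB !linU /trunc.
  rewrite !zs_covers ?neg1_neq0 ?oner_eq0 //.
  have /and3P[fY Yx dY] := cY; rewrite (fintype.subset_trans Yx xw).
  by rewrite /step !mulmA.
rewrite bdry0 [act1 _ _]lin_sum big1 // => Y /andP[cY ZY].
rewrite [lin _ _]linB !linU /trunc !zs_covers ?neg1_neq0 ?oner_eq0 //.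
case: ifP => Yw; last exact: subrr.
suff -> : w ** (x ** dirface 1 Y) = w ** (x ** dirface (-1) Y) by exact: subrr.
have /and3P[fY Yx /eqP dY] := cY.
have EY : Y = zs w :&: zs x.
  apply/eqP; rewrite eqEproper finset.subsetI Yw Yx /=.
  apply/negP => ltY.
  have : (fdim (zs x) < fdim (zs w :&: zs x))%N.
    rewrite -zsM; apply: fdim_proper; first exact: flat_zs.
    rewrite zsM properE finset.subsetIr finset.subsetI fintype.subxx andbT.
    by apply: contra xw.
  by have := fdim_proper fY ltY; rewrite dY ltnS leqNgt => /negP.
apply: face_signP => H; rewrite !mulmA !signM zsM.
case: ifP => // Hwx.
have HY : H \in Y by rewrite EY.
have zero e : e != 0 -> face_sign (dirface e Y) H = Zero.
  move=> e0; have : H \in zs (dirface e Y) by rewrite (zs_dirface uP) ?dY.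
  by rewrite in_zs => /eqP.
by rewrite !zero ?neg1_neq0 ?oner_eq0.
Qed.

Lemma act1_bdry Z w m : act1 w (bdry Z m) = bdry Z (act1 w m).
Proof.
elim/malg_ind: m => [|f x m IH]; first by rewrite act10 bdry0 act10.
by rewrite act1P !bdryP act1P IH bdryU act1U act_bdry1.
Qed.

Lemma act_bdry Z a m : act a (bdry Z m) = bdry Z (act a m).
Proof.
elim/alg_ind: a => [|e w a IH]; first by rewrite !act0 bdry0.
by rewrite (actP e _ a (bdry Z m)) (actP e _ a m) bdryP IH !actU act1_bdry.
Qed.

End Boundary.

(** * Supports, augmentation and restriction of chains *)

Section Supports.
Variables (k : fieldType) (K : choiceType).
Implicit Types (Q : pred K) (c : {malg k[K]}).

Definition supp_in Q c := forall x, x \in msupp c -> Q x.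

Lemma supp_in0 Q : supp_in Q 0.
Proof. by move=> x; rewrite msupp0. Qed.

Lemma supp_inU Q x : Q x -> supp_in Q << x >>.
Proof. by move=> Qx y; rewrite msuppU oner_eq0 !inE => /eqP->. Qed.

Lemma supp_in_linear Q a c c' : supp_in Q c -> supp_in Q c' -> supp_in Q (a *: c + c').
Proof.
move=> Qc Qc' x /(fsubsetP (msuppD_le _ _)); rewrite in_fsetU => /orP[|/Qc'//].
by move=> /(fsubsetP (msuppZ_le _ _))/Qc.
Qed.

Lemma supp_inD Q c c' : supp_in Q c -> supp_in Q c' -> supp_in Q (c + c').
Proof. by move=> Qc; rewrite -[c]scale1r; apply: supp_in_linear. Qed.

Lemma supp_inN Q c : supp_in Q c -> supp_in Q (- c).
Proof. by move=> Qc x; rewrite msuppN; apply: Qc. Qed.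

Lemma supp_inZ Q a c : supp_in Q c -> supp_in Q (a *: c).
Proof. by move=> Qc; rewrite -[_ *: _]addr0; apply: supp_in_linear => //; apply: supp_in0. Qed.

Lemma supp_in_sum Q (I : Type) (r : seq I) (P : pred I) (F : I -> {malg k[K]}) :
  (forall i, P i -> supp_in Q (F i)) -> supp_in Q (\sum_(i <- r | P i) F i).
Proof. by move=> QF; elim/big_ind: _ => //; [exact: supp_in0 | exact: supp_inD]. Qed.

Lemma supp_in_sub Q Q' c : (forall x, Q x -> Q' x) -> supp_in Q c -> supp_in Q' c.
Proof. by move=> QQ' Qc x /Qc/QQ'. Qed.

Lemma supp_in_none Q c : supp_in Q c -> (forall x, ~~ Q x) -> c = 0.
Proof.
move=> Qc nQ; rewrite [c]malg_sum big_seq big1 // => x /Qc Qx.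
by have := nQ x; rewrite Qx.
Qed.

Definition aug (c : {malg k[K]}) : k := lin (fun=> 1 : k^o) c.

Lemma augP (a : k) c c' : aug (a *: c + c') = a * aug c + aug c'.
Proof. exact: (@linP k K k^o _ a c c'). Qed.

Lemma aug0 : aug 0 = 0.
Proof. exact: (@lin0 k K k^o _). Qed.

Lemma augB c c' : aug (c - c') = aug c - aug c'.
Proof. exact: (@linB k K k^o _ c c'). Qed.

Lemma augD c c' : aug (c + c') = aug c + aug c'.
Proof. by rewrite -[c]scale1r augP mul1r scale1r. Qed.

Lemma augZ (a : k) c : aug (a *: c) = a * aug c.
Proof. by rewrite -[a *: c]addr0 augP aug0 addr0. Qed.

Lemma aug_sum (I : Type) (r : seq I) (P : pred I) (F : I -> {malg k[K]}) :
  aug (\sum_(i <- r | P i) F i) = \sum_(i <- r | P i) aug (F i).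
Proof. exact: (@lin_sum k K k^o _ I r P F). Qed.

Lemma augU x : aug << x >> = 1.
Proof. exact: (@linU k K k^o _ x). Qed.

Definition cut Q : {malg k[K]} -> {malg k[K]} :=
  lin (fun x => if Q x then << x >> else 0).

Lemma cutP Q (a : k) c c' : cut Q (a *: c + c') = a *: cut Q c + cut Q c'.
Proof. exact: linP. Qed.

Lemma cut0 Q : cut Q 0 = 0.
Proof. exact: lin0. Qed.

Lemma cutB Q c c' : cut Q (c - c') = cut Q c - cut Q c'.
Proof. exact: linB. Qed.

Lemma cutZ Q (a : k) c : cut Q (a *: c) = a *: cut Q c.
Proof. by rewrite -[a *: c]addr0 cutP cut0 addr0. Qed.

Lemma cut_sum Q (I : Type) (r : seq I) (P : pred I) (F : I -> {malg k[K]}) :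
  cut Q (\sum_(i <- r | P i) F i) = \sum_(i <- r | P i) cut Q (F i).
Proof. exact: lin_sum. Qed.

Lemma cutU Q x : cut Q << x >> = if Q x then << x >> else 0.
Proof. exact: linU. Qed.

Lemma cut_id Q c : supp_in Q c -> cut Q c = c.
Proof.
move=> Qc; rewrite {2}[c]malg_sum {1}[c]malg_sum cut_sum big_seq [RHS]big_seq.
by apply: eq_bigr => x /Qc Qx; rewrite cutZ cutU Qx.
Qed.

Lemma cut_supp Q Q' c : supp_in Q' c -> supp_in [pred x | Q x && Q' x] (cut Q c).
Proof.
move=> Qc; rewrite [c]malg_sum big_seq cut_sum; apply: supp_in_sum => x /Qc Q'x.
rewrite cutZ cutU; apply: supp_inZ; case: ifP => Qx; last exact: supp_in0.
by apply: supp_inU; rewrite /= Qx.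
Qed.

Lemma cut_coef Q c x : (cut Q c)@_x = if Q x then c@_x else 0.
Proof.
elim/malg_ind: c => [|a y c IH]; first by rewrite cut0 mcoeff0 if_same.
rewrite cutP !mcoeffD !mcoeffZ IH cutU; have [<-|yx] := eqVneq y x.
  by case: ifP; rewrite ?mcoeff0 ?mulr0 ?addr0.
by case: (Q y); case: (Q x); rewrite ?mcoeffU ?(negbTE yx) ?mcoeff0 ?mulr0n ?mulr0 ?add0r.
Qed.

Lemma supp_in_lin (K' : choiceType) Q (f : K' -> {malg k[K]}) (c : {malg k[K']}) :
  (forall x, x \in msupp c -> supp_in Q (f x)) -> supp_in Q (lin f c).
Proof.
move=> Qf; rewrite [lin f c]big_seq; apply: supp_in_sum => x /Qf; exact: supp_inZ.
Qed.

End Supports.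

(** * Exactness of convex regions *)

Section Exactness.
Variables (R : realType) (d : nat) (A : {fset {vspace 'rV[R]_d}}).
Variables (L : labelling A) (k : fieldType).
Local Notation face := (face L).
Local Notation chain := {malg k[face]}.
Local Notation "x ** y" := (@mmul face x y) (at level 40, left associativity).
Implicit Types (x y z w : face) (S T X Y Z D : {set A}) (H : A) (c m : chain).

Variables (u : {set A} -> 'rV[R]_d) (uP : generic_directions u).
Local Notation dirface := (dirface L u).
Local Notation bdry := (@bdry R d A L k u).

Lemma mem_bdry1 Z x : supp_in [pred y | [&& Z \subset zs y, zs y \subset zs x,
    fdim (zs y) == (fdim (zs x)).+1 &
    [forall H, (face_sign x H != Zero) ==> (face_sign y H == face_sign x H)]]]
  (bdry Z << x >>).
Proof.
rewrite bdryU /bdry1; apply: supp_in_sum => Y /andP[cY ZY].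
have mem e : e != 0 -> supp_in [pred y | [&& Z \subset zs y, zs y \subset zs x,
    fdim (zs y) == (fdim (zs x)).+1 &
    [forall H, (face_sign x H != Zero) ==> (face_sign y H == face_sign x H)]]]
    (<< x ** dirface e Y >> : chain).
  move=> e0; apply: supp_inU => /=; rewrite (zs_covers uP) // ZY.
  have /and3P[_ -> ->] := cY; apply/forallP => H; apply/implyP => xH.
  by rewrite signM in_zs (negbTE xH).
apply: supp_inD; [|apply: supp_inN]; apply: mem; first exact: oner_neq0.
exact: neg1_neq0.
Qed.

Lemma aug_bdry Z c : aug (bdry Z c) = 0.
Proof.
elim/malg_ind: c => [|a x c IH]; first by rewrite bdry0 aug0.
rewrite bdryP augP IH addr0 bdryU /bdry1 aug_sum big1 ?mulr0 // => Y _.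
by rewrite augB !augU subrr.
Qed.

(** The faces in the flat of z that lie, for each hyperplane of D, on the same
    side as z. Their union is convex and relatively open in that flat. *)
Definition region D z x :=
  (zs z \subset zs x) && [forall H in D, face_sign x H == face_sign z H].

Lemma regionP D z x : reflect
  (zs z \subset zs x /\ forall H, H \in D -> face_sign x H = face_sign z H) (region D z x).
Proof.
apply: (iffP andP) => [[zx /forall_inP xz]|[zx xz]]; split=> //.
  by move=> H /xz/eqP.
by apply/forall_inP => H /xz->.
Qed.

Definition codim_in z p x := (fdim (zs x) + p)%N == fdim (zs z).

(** The augmented complex of the faces of a region has no homology, as expected
    of a convex set. *)
Definition exact_at D z := forall p c,
  supp_in [pred x | region D z x && codim_in z p x] c ->
  bdry (zs z) c = 0 -> (p = 0%N -> aug c = 0) ->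
  exists2 c', supp_in [pred x | region D z x && codim_in z p.+1 x] c' &
    bdry (zs z) c' = c.

Lemma exact_at_congr D D' z : region D z =1 region D' z -> exact_at D' z -> exact_at D z.
Proof.
move=> DD' ex p c cD cyc ac.
have [|c' c'D <-] := ex p c _ cyc ac.
  by apply: supp_in_sub cD => x /=; rewrite DD'.
by exists c' => //; apply: supp_in_sub c'D => x /=; rewrite DD'.
Qed.

(** With every hyperplane in D, the region has z as its only face. *)
Lemma exact_at_full z : exact_at [set: A] z.
Proof.
move=> p c cz cyc ac; exists 0; rewrite ?bdry0; first exact: supp_in0.
have z_only x : region [set: A] z x && codim_in z p x -> (x == z) && (p == 0%N).
  move=> /andP[/regionP[_ xz] /eqP].
  have -> : x = z by apply: face_signP => H; apply: xz; rewrite inE.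
  by rewrite eqxx => ?; apply/eqP; lia.
case: p {cyc} ac z_only cz => [/(_ erefl) ac|p _] z_only cz; last first.
  by rewrite (supp_in_none cz) // => x; apply/negP => /z_only; rewrite andbF.
suff cE : c = c@_z *: << z >>.
  by move: ac; rewrite cE augZ augU mulr1 => ->; rewrite scale0r.
apply/malgP => x; rewrite mcoeffZ mcoeffU; have [<-|zx] := eqVneq z x; first by rewrite mulr1.
rewrite mulr0 mcoeff_outdom //; apply: contra zx => /cz/z_only; rewrite andbT eq_sym //.
Qed.

(** By convexity: the segment joining two faces of the region on different sides
    of H crosses H inside the region. *)
Lemma region_cut D z H : H \notin zs z ->
  (exists2 x0, region D z x0 & H \in zs x0) \/ region D z =1 region (H |: D) z.
Proof.
move=> Hz; case: (pselect (exists2 x0, region D z x0 & H \in zs x0)); first by left.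
move=> no; right=> x; apply/idP/idP => /regionP[zx xz]; apply/regionP; split=> // H'; last first.
  by move=> H'D; apply: xz; rewrite !inE H'D orbT.
rewrite !inE => /predU1P[->{H'}|/xz//].
have [p px] := face_of_surj x; have [q qz] := face_of_surj z.
pose a := hform L H p; pose b := hform L H q.
have a0 : a != 0.
  rewrite -in_zs_of px; apply/negP => Hx; apply: no; exists x => //.
  by apply/regionP.
have b0 : b != 0 by rewrite -in_zs_of qz.
rewrite -px -qz !face_ofE -/a -/b.
have [ab|ab] := ltP 0 (a * b); first by rewrite -[a]mulr1 -[b]mulr1 (sign_of_scale 1 ab).
(* The point where the segment from p to q crosses H. *)
exfalso; apply: no; exists (face_of L (`|b| *: p + `|a| *: q)); last first.
  rewrite in_zs_of hformD !hformZ -/a -/b.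
  have [a_gt0|a_le0] := ltrP 0 a.
    have b_lt0 : b < 0 by rewrite lt_neqAle b0; nra.
    by rewrite (gtr0_norm a_gt0) (ltr0_norm b_lt0); apply/eqP; lra.
  have a_lt0 : a < 0 by rewrite lt_neqAle a0.
  have b_gt0 : 0 < b by rewrite lt_neqAle eq_sym b0; nra.
  by rewrite (ltr0_norm a_lt0) (gtr0_norm b_gt0); apply/eqP; lra.
apply/regionP; split=> [|H' H'D].
  apply/fintype.subsetP => H' H'z; have := fintype.subsetP zx H' H'z.
  move: H'z; rewrite -px -{1}qz !in_zs_of hformD !hformZ => /eqP-> /eqP->.
  by rewrite !mulr0 addr0.
have := xz H' H'D; rewrite -{1}px -{1}qz !face_ofE hformD !hformZ => pq.
by rewrite sign_of_convex ?normr_gt0 // pq -face_ofE qz.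
Qed.

End Exactness.

Section CutRegion.
Variables (R : realType) (d : nat) (A : {fset {vspace 'rV[R]_d}}).
Variables (L : labelling A) (k : fieldType).
Local Notation face := (face L).
Local Notation chain := {malg k[face]}.
Local Notation "x ** y" := (@mmul face x y) (at level 40, left associativity).
Implicit Types (x y w : face) (S T X Y Z : {set A}) (c m : chain).

Variables (u : {set A} -> 'rV[R]_d) (uP : generic_directions u).
Local Notation dirface := (dirface L u).
Local Notation bdry := (@bdry R d A L k u).
Local Notation step := (@step R d A L k u).
Local Notation exact_at := (@exact_at R d A L k u).

Variables (D : {set A}) (z x0 : face) (H : A).
Hypotheses (Hz : H \notin zs z) (x0U : region D z x0) (Hx0 : H \in zs x0).
Hypothesis x0_min : forall x, region D z x -> H \in zs x -> (#|zs x0| <= #|zs x|)%N.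

Let z_x0 : zs z \subset zs x0.
Proof. by have /regionP[] := x0U. Qed.

(** The face x0 spans the whole intersection of H with the flat of z. For v in
    this intersection, x0 times the face of v is again a face of the region inside
    H, and lies on no hyperplane missing x0; by minimality it lies on the same
    ones as x0, so these contain v. *)
Lemma fspan_wall v : (v \in fspan (zs x0)) = (v \in fspan (zs z)) && (hform L H v == 0).
Proof.
apply/idP/andP => [vx0|[vz /eqP vH]].
  split; first exact: subvP (fspanS L z_x0) _ vx0.
  by have /fspanP/(_ H Hx0)-> := vx0.
pose y := x0 ** face_of L v.
have zsy : zs y = zs x0 :&: zs (face_of L v) by rewrite zsM.
have yU : region D z y.
  apply/regionP; split.
    by rewrite zsy finset.subsetI z_x0 -fspan_zs.
  move=> H' H'D; have /regionP[_ /(_ H' H'D) x0z] := x0U.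
  rewrite signM; case: ifP => // H'x0; move: (H'x0); rewrite in_zs x0z => H'z.
  move: vz; rewrite (fspan_zs L) => /fintype.subsetP/(_ H').
  by rewrite !in_zs => /(_ H'z)/eqP->; apply/eqP; rewrite eq_sym.
have Hy : H \in zs y by rewrite zsy inE Hx0 in_zs_of vH eqxx.
have : zs y = zs x0.
  by apply/eqP; rewrite eqEcard x0_min // zsy finset.subsetIl.
by rewrite zsy (fspan_zs L) => /finset.setIidPl.
Qed.

Lemma fdim_wall : fdim (zs z) = (fdim (zs x0)).+1.
Proof.
have E : fspan (zs x0) = (fspan (zs z) :&: lker (lform L H))%VS.
  apply/vspaceP => v.
  by rewrite fspan_wall memv_cap memv_ker.
have := limg_ker_dim (lform L H) (fspan (zs z)).
rewrite -E /fdim => <-; rewrite -[RHS]addn1; congr (_ + _)%N; apply/eqP.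
rewrite eqn_leq (leq_trans (dimvS (subvf _))) ?dimvf //= lt0n dimv_eq0.
have [p pz] := face_of_surj z; apply: contra Hz => /eqP img0.
have pZ : p \in fspan (zs z) by rewrite (fspan_zs L) pz.
have : lform L H p \in (lform L H @: fspan (zs z))%VS by apply: memv_img.
by rewrite img0 memv0 -pz in_zs_of.
Qed.

Let dz_gt0 : (0 < fdim (zs z))%N. Proof. by rewrite fdim_wall. Qed.

Lemma covers_wall : covers L (zs x0) (zs z).
Proof. by rewrite /covers flat_zs z_x0 fdim_wall eqxx. Qed.

(** The flats of the complex that lie in H are those of the complex of x0. *)
Lemma wall_sub Y : flat L Y -> zs z \subset Y -> (zs x0 \subset Y) = (H \in Y).
Proof.
move=> fY zY; apply/idP/idP => [/fintype.subsetP/(_ H Hx0)//|HY].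
apply: (flat_span (L := L)) => //; apply/subvP => v vY.
rewrite fspan_wall (subvP (fspanS L zY)) //=; have /fspanP/(_ H HY)-> := vY.
exact: eqxx.
Qed.

Definition side e := x0 ** dirface e (zs z).

Lemma zs_side e : e != 0 -> zs (side e) = zs z.
Proof. by move=> e0; apply: zs_covers; rewrite ?covers_wall. Qed.

Lemma sign_side e : face_sign (side e) H = sign_of (e * hform L H (u (zs z))).
Proof. by rewrite signM Hx0 face_ofE hformZ. Qed.

Let h_neq0 : hform L H (u (zs z)) != 0.
Proof. by rewrite -in_zs_of (zs_dir uP) ?flat_zs. Qed.

Lemma sign_wall e x : H \in zs x ->
  face_sign (x ** dirface e (zs z)) H = face_sign (side e) H.
Proof. by move=> Hx; rewrite !signM Hx Hx0. Qed.

Lemma side_cases x :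
  [\/ face_sign x H = Zero, face_sign x H = face_sign (side 1) H |
      face_sign x H = face_sign (side (-1)) H].
Proof.
rewrite !sign_side mul1r mulN1r /sign_of oppr_eq0 (negbTE h_neq0) oppr_gt0.
move: h_neq0; case: ltgtP => // _ _; case: (face_sign x H).
all: by [constructor 1|constructor 2|constructor 3].
Qed.

Lemma side_neq0 e : e != 0 -> face_sign (side e) H != Zero.
Proof. by move=> e0; rewrite -in_zs zs_side. Qed.

Lemma side_neq : face_sign (side 1) H != face_sign (side (-1)) H.
Proof.
rewrite !sign_side mul1r mulN1r /sign_of oppr_eq0 (negbTE h_neq0) oppr_gt0.
by move: h_neq0; case: ltgtP => // _ _; apply/eqP.
Qed.

Local Notation on s := (fun x : face => face_sign x H == s).

Lemma region_side e x : e != 0 ->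
  region (H |: D) (side e) x = region D z x && (face_sign x H == face_sign (side e) H).
Proof.
move=> e0; have signD H' : H' \in D -> face_sign (side e) H' = face_sign z H'.
  move=> H'D; have /regionP[_ /(_ H' H'D) x0z] := x0U.
  rewrite signM; case: ifP => //; rewrite in_zs x0z -in_zs => H'z.
  have : H' \in zs (dirface e (zs z)) by rewrite (zs_dirface uP) ?flat_zs.
  by move: H'z; rewrite !in_zs => /eqP-> /eqP->.
apply/regionP/andP => [[]|[/regionP[zx xz] /eqP xH]]; rewrite zs_side //.
  move=> zx xside; split; last by apply/eqP/xside; rewrite !inE eqxx.
  by apply/regionP; split=> // H' H'D; rewrite -signD // xside // !inE H'D orbT.
by split=> // H'; rewrite !inE => /predU1P[->//|H'D]; rewrite signD // xz.
Qed.

Lemma region_wall x : region (H |: D) x0 x = region D z x && (face_sign x H == Zero).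
Proof.
have /regionP[_ x0z] := x0U.
apply/regionP/andP => [[x0x xx0]|[/regionP[zx xz] xH]].
  split; last by rewrite -in_zs (fintype.subsetP x0x).
  apply/regionP; split; first exact: fintype.subset_trans x0x.
  by move=> H' H'D; rewrite -x0z // xx0 // !inE H'D orbT.
split; last first.
  move=> H'; rewrite !inE => /predU1P[->|H'D]; last by rewrite x0z ?xz.
  by move: Hx0; rewrite (eqP xH) in_zs => /eqP.
by rewrite wall_sub ?flat_zs // in_zs.
Qed.

Lemma bdry_region x : region D z x ->
  supp_in [pred y | [&& region D z y, fdim (zs y) == (fdim (zs x)).+1 &
    (face_sign x H != Zero) ==> (face_sign y H == face_sign x H)]]
  (bdry (zs z) << x >> : chain).
Proof.
move=> /regionP[zx xz]; apply: (supp_in_sub _ (@mem_bdry1 _ _ _ _ k _ uP _ _)) => y /=.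
case/and4P=> zy yx dy /forallP xy; rewrite dy (xy H) !andbT.
apply/regionP; split=> // H' H'D; have [x0'|xn0] := eqVneq (face_sign x H') Zero.
  rewrite -xz // x0'; have : H' \in zs z by rewrite in_zs -xz // x0'.
  by move=> /(fintype.subsetP zy); rewrite in_zs => /eqP.
by have := xy H'; rewrite xn0 => /eqP->; apply: xz.
Qed.

Lemma cut_bdry_off x s : region D z x -> face_sign x H != Zero ->
  cut (on s) (bdry (zs z) << x >>) = bdry (zs z) (cut (on s) << x >>) :> chain.
Proof.
move=> xU xH; have sup := bdry_region xU; rewrite cutU; case: eqP => [xs|xs].
  apply: cut_id; apply: supp_in_sub sup => y /= /and3P[_ _].
  by rewrite xH xs.
rewrite bdry0; apply: (@supp_in_none _ _ _ _ (cut_supp sup)) => y /=.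
apply/negP => /and4P[/eqP ys _ _]; rewrite xH ys => /eqP sx; exact: xs.
Qed.

(** A coface of x in the flat Y stays in H exactly when Y lies in H. *)
Lemma cut_bdry_wall x : region D z x -> face_sign x H = Zero ->
  cut (on Zero) (bdry (zs z) << x >>) = bdry (zs x0) << x >> :> chain.
Proof.
move=> /regionP[zx xz] xH; rewrite !bdryU /bdry1 cut_sum.
rewrite (bigID (fun Y => H \in Y)) /= [X in _ + X]big1 ?addr0.
  apply: eq_big => [Y|Y /andP[/andP[cY zY] HY]].
    case cY : (covers _ _ _) => //=.
    case zY : (zs z \subset Y) => /=; first by rewrite wall_sub //; case/and3P: cY.
    by apply/esym/negbTE; apply: contraFN zY; apply: fintype.subset_trans.
  rewrite cut_id //; apply: supp_inD; [|apply: supp_inN]; apply: supp_inU;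
    by rewrite -in_zs (zs_covers uP) ?neg1_neq0 ?oner_neq0.
move=> Y /andP[/andP[cY zY] HY].
have off e : e != 0 -> ~~ on Zero (x ** dirface e Y).
  by move=> e0; rewrite -in_zs (zs_covers uP).
rewrite cutB !cutU (negbTE (off _ (oner_neq0 _))) (negbTE (off _ (neg1_neq0 _))).
exact: subrr.
Qed.

Lemma bdry_wall x : zs x = zs x0 ->
  bdry (zs z) << x >> = << x ** dirface 1 (zs z) >> - << x ** dirface (-1) (zs z) >> :> chain.
Proof.
move=> xx0; rewrite bdryU /bdry1 (big_pred1 (zs z)) // => Y /=; rewrite xx0.
apply/idP/eqP => [/andP[/and3P[fY Yx0 /eqP dY] zY]|->].
  by apply/esym/(fdim_eq (flat_zs z)) => //; rewrite fdim_wall.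
by rewrite covers_wall fintype.subxx.
Qed.

Lemma bdryZ Z (a : k) c : bdry Z (a *: c) = a *: bdry Z c.
Proof. by rewrite -[a *: c]addr0 bdryP bdry0 addr0. Qed.

Lemma bdry_supp p c : supp_in [pred x | region D z x && codim_in z p.+1 x] c ->
  supp_in [pred x | region D z x && codim_in z p x] (bdry (zs z) c).
Proof.
move=> cU; rewrite /bdry; apply: supp_in_lin => x /cU/andP[xU /eqP xp].
rewrite -(@bdryU _ _ _ _ k); apply: supp_in_sub (bdry_region xU) => y /= /and3P[-> /eqP dy _].
by rewrite /codim_in dy addSnnS xp eqxx.
Qed.

Lemma codim_wall x p : zs x0 \subset zs x -> codim_in z p x -> (0 < p)%N.
Proof.
move=> /fdimS-/(_ L); rewrite /codim_in fdim_wall; case: p => // le /eqP.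
by rewrite addn0 => dx; rewrite dx ltnn in le.
Qed.

Local Notation deg p := [pred x | region D z x && codim_in z p x].

(** The part of a cycle on H is a cycle of the wall, in one degree less, hence the
    boundary of a chain of the wall. Subtracting the boundary of that chain taken
    in the whole region moves the cycle off H. In degree 0 there is nothing on H,
    and a multiple of x0 balances the augmentations of the two sides. *)
Lemma kill_wall p c : (forall z', exact_at (H |: D) z') ->
    supp_in (deg p) c -> bdry (zs z) c = 0 -> (p = 0%N -> aug c = 0) ->
  exists2 e, supp_in (deg p.+1) e & cut (on Zero) (c - bdry (zs z) e) = 0 /\
    (p = 0%N -> aug (cut (on (face_sign (side 1) H)) (c - bdry (zs z) e)) = 0).
Proof.
move=> IH cU cyc ac.
have wallU x q : on Zero x && ((deg q) x) -> [/\ region (H |: D) x0 x, (0 < q)%N & codim_in x0 q.-1 x].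
  move=> /and3P[xH xU xq]; have xU' : region (H |: D) x0 x by rewrite region_wall xU.
  have /regionP[x0x _] := xU'; have q0 := codim_wall x0x xq; split=> //.
  by move: xq; rewrite /codim_in fdim_wall -{1}(prednK q0) addnS eqSS.
case: p => [|p] in cU ac *.
  have c0 : cut (on Zero) c = 0.
    by apply: (supp_in_none (cut_supp cU)) => x; apply/negP => /wallU[].
  have b0 : bdry (zs z) << x0 >> = << side 1 >> - << side (-1) >> :> chain by rewrite bdry_wall.
  exists (aug (cut (on (face_sign (side 1) H)) c) *: << x0 >>).
    apply: supp_inZ; apply: supp_inU; rewrite /= x0U /codim_in fdim_wall addn1.
    exact: eqxx.
  rewrite bdryZ b0 !cutB c0 !cutZ !cutB !cutU; split.
    rewrite (negbTE (side_neq0 (oner_neq0 _))) (negbTE (side_neq0 (neg1_neq0 _))).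
    by rewrite subrr scaler0 subrr.
  move=> _; rewrite eqxx eq_sym (negbTE side_neq) subr0 augB augZ augU mulr1.
  exact: subrr.
have c0U : supp_in [pred x | region (H |: D) x0 x && codim_in x0 p x] (cut (on Zero) c).
  by apply: supp_in_sub (cut_supp cU) => x /wallU[/= -> _ ->].
have off x : x \in msupp c -> region D z x by move/cU => /andP[].
have cyc0 : bdry (zs x0) (cut (on Zero) c) = 0.
  rewrite -[RHS](cut0 k (on Zero)) -cyc.
  apply: (@linear_eq_in k face chain (fun c => bdry (zs x0) (cut (on Zero) c))
            (fun c => cut (on Zero) (bdry (zs z) c))) => [a b b'|a b b'|x /off xU].
  - by rewrite cutP bdryP.
  - by rewrite bdryP cutP.
  have [xH|xH] := eqVneq (face_sign x H) Zero.
    by rewrite cutU xH eqxx -cut_bdry_wall.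
  by rewrite cut_bdry_off // cutU (negbTE xH) !bdry0.
(* A face of codimension 1 on H has one coface on each side; the boundary of the
   part of c off H has augmentation 0 on each side. *)
have ac0 : p = 0%N -> aug (cut (on Zero) c) = 0.
  move=> p0; rewrite p0 in cU.
  rewrite -[RHS](aug0 k face) -[X in _ = aug X](cut0 k (on (face_sign (side 1) H))) -cyc.
  apply: (@linear_eq_in k face k^o (fun c => aug (cut (on Zero) c))
            (fun c => aug (cut (on (face_sign (side 1) H)) (bdry (zs z) c)))) => [a b b'|a b b'|x xc].
  - by rewrite cutP augP.
  - by rewrite bdryP cutP augP.
  have xU := off _ xc; have [xH|xH] := eqVneq (face_sign x H) Zero.
    have xx0 : zs x = zs x0.
      have [|xU' _] := @wallU x 1%N; first by rewrite /= xH eqxx; exact: cU.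
      have /regionP[x0x _] := xU'.
      rewrite /codim_in addn0 => /eqP dx.
      by apply/esym/(fdim_eq (flat_zs x0)).
    rewrite (bdry_wall xx0) cutB !cutU xH !sign_wall ?in_zs ?xH // !eqxx.
    by rewrite eq_sym (negbTE side_neq) subr0 !augU.
  have -> : cut (on Zero) << x >> = 0 :> chain by rewrite cutU (negbTE xH).
  by rewrite aug0 cut_bdry_off // aug_bdry.
have [e eU be] := IH x0 p _ c0U cyc0 ac0.
have eH x : x \in msupp e -> region D z x && (face_sign x H == Zero).
  by move=> /eU/andP[]; rewrite region_wall.
exists e.
  move=> x xe; have /andP[xU _] := eH _ xe; rewrite /= xU /=.
  have /andP[_] := eU x xe; rewrite /codim_in fdim_wall => /eqP <-.
  by rewrite addnS.
split=> //; suff -> : cut (on Zero) (c - bdry (zs z) e) = cut (on Zero) c - bdry (zs x0) e.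
  by rewrite be subrr.
rewrite cutB; congr (_ - _).
apply: (@linear_eq_in k face chain (fun c => cut (on Zero) (bdry (zs z) c))
          (fun c => bdry (zs x0) c)) => [a b b'|a b b'|x /eH/andP[xU /eqP xH]].
- by rewrite bdryP cutP.
- by rewrite bdryP.
exact: cut_bdry_wall.
Qed.

Lemma cut_split c : cut (on Zero) c = 0 ->
  c = cut (on (face_sign (side 1) H)) c + cut (on (face_sign (side (-1)) H)) c.
Proof.
move=> c0; rewrite -[LHS]subr0 -c0.
apply: (@linear_eq_in k face chain (fun c => c - cut (on Zero) c) (fun c =>
  cut (on (face_sign (side 1) H)) c + cut (on (face_sign (side (-1)) H)) c)) => [a b b'|a b b'|x _].
- by rewrite cutP opprD addrACA -scalerBr.
- by rewrite !cutP addrACA -scalerDr.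
have s1 := side_neq0 (oner_neq0 R); have sm := side_neq0 (neg1_neq0 R).
rewrite !cutU; case: (side_cases x) => ->.
- by rewrite eqxx ![Zero == _]eq_sym (negbTE s1) (negbTE sm) addr0 subrr.
- by rewrite eqxx (negbTE s1) (negbTE side_neq) subr0 addr0.
by rewrite eqxx (negbTE sm) eq_sym (negbTE side_neq) subr0 add0r.
Qed.

Lemma kill_side p c e : e != 0 -> (forall z', exact_at (H |: D) z') ->
    supp_in (deg p) c -> bdry (zs z) c = 0 -> cut (on Zero) c = 0 ->
    (p = 0%N -> aug (cut (on (face_sign (side e) H)) c) = 0) ->
  exists2 e', supp_in (deg p.+1) e' &
    bdry (zs z) e' = cut (on (face_sign (side e) H)) c.
Proof.
move=> e0 IH cU cyc c0 ac.
have xU x : x \in msupp c -> region D z x by move=> /cU/andP[].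
have xH x : x \in msupp c -> face_sign x H != Zero.
  apply: contraTneq => xH; rewrite -mcoeff_neq0 negbK.
  by have := cut_coef (on Zero) c x; rewrite c0 mcoeff0 xH eqxx => <-.
have cU' : supp_in [pred x | region (H |: D) (side e) x && codim_in (side e) p x]
    (cut (on (face_sign (side e) H)) c).
  apply: supp_in_sub (cut_supp cU) => x /= /and3P[xe xD xp].
  by rewrite region_side // xD xe /codim_in zs_side.
have cyc' : bdry (zs (side e)) (cut (on (face_sign (side e) H)) c) = 0.
  rewrite zs_side // -[RHS](cut0 k (on (face_sign (side e) H))) -cyc; apply/esym.
  apply: (@linear_eq_in k face chain
    (fun c => cut (on (face_sign (side e) H)) (bdry (zs z) c))
    (fun c => bdry (zs z) (cut (on (face_sign (side e) H)) c))) => [a b b'|a b b'|x xc].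
  - by rewrite bdryP cutP.
  - by rewrite cutP bdryP.
  by apply: cut_bdry_off; [exact: xU | exact: xH].
have [e' e'U be'] := IH (side e) p _ cU' cyc' ac.
exists e'; last by rewrite -be' zs_side.
apply: supp_in_sub e'U => x /=; rewrite region_side // /codim_in zs_side //.
by case/andP=> /andP[-> _] ->.
Qed.

(** A Mayer-Vietoris argument: H cuts the region into two sides and a wall, three
    smaller convex regions. *)
Lemma exact_at_cut : (forall z', exact_at (H |: D) z') -> exact_at D z.
Proof.
move=> IH p c cU cyc ac; have [e eU [e0 ea]] := kill_wall IH cU cyc ac.
pose c' := c - bdry (zs z) e.
have c'U : supp_in (deg p) c' by apply: supp_inD => //; apply/supp_inN/bdry_supp.
have cyc' : bdry (zs z) c' = 0 by rewrite bdryB cyc bdry_sq // subr0.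
have c'E : c' = cut (on (face_sign (side 1) H)) c' +
    cut (on (face_sign (side (-1)) H)) c' by exact: cut_split.
have acm : p = 0%N -> aug (cut (on (face_sign (side (-1)) H)) c') = 0.
  move=> p0; have a0 : aug c' = 0 by rewrite augB ac // aug_bdry subrr.
  by have := congr1 (@aug k face) c'E; rewrite a0 augD (ea p0) add0r => /esym.
have [e1 e1U b1] := kill_side (oner_neq0 R) IH c'U cyc' e0 ea.
have [e2 e2U b2] := kill_side (neg1_neq0 R) IH c'U cyc' e0 acm.
exists (e + (e1 + e2)); first by apply: supp_inD => //; apply: supp_inD.
have bD a b : bdry (zs z) (a + b) = bdry (zs z) a + bdry (zs z) b.
  by rewrite -[a]scale1r bdryP !scale1r.
by rewrite !bD b1 b2 -c'E /c' addrC subrK.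
Qed.

End CutRegion.

Section Exact.
Variables (R : realType) (d : nat) (A : {fset {vspace 'rV[R]_d}}).
Variables (L : labelling A) (k : fieldType).
Local Notation face := (face L).
Variables (u : {set A} -> 'rV[R]_d) (uP : generic_directions u).

Lemma exact_at_any (D : {set A}) (z : face) : exact_at k u D z.
Proof.
move: {2}#|~: D| (erefl #|~: D|) => n; elim: n D z => [|n IH] D z Dn.
  have -> : D = [set: A].
    by apply/eqP; rewrite -[D == _](inj_eq (@finset.setC_inj _)) finset.setCT -cards_eq0 Dn.
  exact: exact_at_full.
have /card_gt0P[H] : (0 < #|~: D|)%N by rewrite Dn.
rewrite inE => HD.
have {}IH (z' : face) : exact_at k u (H |: D) z'.
  apply: IH; move: Dn; rewrite (cardsD1 H) inE HD add1n => -[<-].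
  by apply: eq_card => H'; rewrite !inE negb_or.
case: (boolP (H \in zs z)) => Hz.
  apply: exact_at_congr (IH z) => x; apply/idP/idP => /regionP[zx xz]; apply/regionP; split=> // H'.
    rewrite !inE => /predU1P[->|/xz//].
    by have := fintype.subsetP zx _ Hz; move: Hz; rewrite !in_zs => /eqP-> /eqP->.
  by move=> H'D; apply: xz; rewrite !inE H'D orbT.
have [[x0 x0U Hx0]|reg] := region_cut D Hz; last exact: exact_at_congr (IH z).
(* A face of the region on as few hyperplanes as possible spans the wall. *)
pose P n := `[< exists x, [/\ region D z x, H \in zs x & #|zs x| = n] >].
have exP : exists n, P n by exists #|zs x0|; apply/asboolP; exists x0.
case: (ex_minnP exP) => m /asboolP[x1 [x1U Hx1 <-]] min1.
apply: (exact_at_cut uP Hz x1U Hx1) => // x xU Hx.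
by apply: min1; apply/asboolP; exists x.
Qed.

Lemma bdry_exact (z : face) p (c : {malg k[face]}) :
  supp_in [pred x | (zs z \subset zs x) && codim_in z p x] c ->
  bdry u (zs z) c = 0 -> (p = 0%N -> aug c = 0) ->
  exists2 c', supp_in [pred x | (zs z \subset zs x) && codim_in z p.+1 x] c' &
    bdry u (zs z) c' = c.
Proof.
have reg x : region finset.set0 z x = (zs z \subset zs x).
  apply/regionP/idP => [[]//|zx]; split=> // H; by rewrite inE.
move=> cU cyc ac; have [|c' c'U <-] := @exact_at_any finset.set0 z p c _ cyc ac.
  by apply: supp_in_sub cU => x /=; rewrite reg.
by exists c' => //; apply: supp_in_sub c'U => x /=; rewrite reg.
Qed.

End Exact.

(** * Orthogonal idempotents indexed by flats *)

(** B stands for the face algebra, spanned by the elements fe w of the faces. *)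
Section Idempotents.
Variables (R : realType) (d : nat) (A : {fset {vspace 'rV[R]_d}}).
Variables (L : labelling A) (k : fieldType) (B : algType k).
Local Notation face := (face L).
Local Notation "x ** y" := (@mmul face x y) (at level 40, left associativity).
Local Notation flat := (flat L).
Implicit Types (x y z w : face) (S T X Y Z : {set A}) (H : A) (a b : B).

Variable fe : face -> B.
Hypotheses (feM : forall x y, fe x * fe y = fe (x ** y)) (fe1 : fe mone = 1).
Hypothesis fe_ind : forall P : B -> Prop, P 0 ->
  (forall (c : k) w a, P a -> P (c *: fe w + a)) -> forall a, P a.

Definition flat_face X : face :=
  if pselect (exists x, zs x = X) is left ex then sval (cid ex) else mone.

Lemma zs_flat_face X : flat X -> zs (flat_face X) = X.
Proof.
move=> /flatP ex; rewrite /flat_face; case: pselect => // ex'.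
exact: svalP (cid ex').
Qed.

(** The recursion e_X = l_X (1 - sum of e_Y), where l_X is a face spanning X and Y
    runs over the flats strictly containing X, which are proper subsets of X. *)
Fixpoint idem_rec n X : B := if n is n'.+1 then
  fe (flat_face X) * (1 - \sum_(Y | flat Y && (Y \proper X)) idem_rec n' Y) else 0.

Fact idem_key : unit. Proof. by []. Qed.
Definition idem X := locked_with idem_key (idem_rec #|X|.+1 X).

Lemma idemE X :
  idem X = fe (flat_face X) * (1 - \sum_(Y | flat Y && (Y \proper X)) idem Y).
Proof.
rewrite {1}/idem locked_withE /=; congr (_ * (1 - _)); apply: eq_bigr => Y /andP[_ YX].
have: (#|Y| < #|X|)%N by exact: proper_card.
rewrite /idem locked_withE; move: #|X| => n.
have fuel m n' Z : (#|Z| < m)%N -> (#|Z| < n')%N -> idem_rec m Z = idem_rec n' Z.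
  elim: m n' Z => // m IH [|n'] // Z Zm Zn /=; congr (_ * (1 - _)).
  apply: eq_bigr => W /andP[_ /proper_card WZ].
  by apply: IH; apply: leq_trans WZ _.
by move=> Yn; apply: fuel.
Qed.

(** Multiply the recursion for the flat X of z by z on the left: as z l_X = z, it
    says that z e_X is z minus the other terms of the sum. *)
Lemma fe_idem_sum z : fe z * (\sum_(Y | flat Y && (Y \subset zs z)) idem Y) = fe z.
Proof.
rewrite (bigD1 (zs z)) /=; last by rewrite flat_zs fintype.subxx.
rewrite [in X in X + _]idemE mulrDr mulrA feM mul_absorb; last first.
  by rewrite zs_flat_face ?flat_zs // fintype.subxx.
rewrite mulrBr mulr1.
rewrite [X in _ + _ * X](eq_bigl (fun Y => flat Y && (Y \proper zs z))) ?subrK //.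
by move=> Y; rewrite finset.properEneq [_ && (Y != _)]andbC andbCA.
Qed.

(** The face w l_X spans a flat V strictly containing X. By induction only the
    e_Y with Y containing V survive in the recursion, and by [fe_idem_sum] their
    sum fixes w l_X. *)
Lemma fe_idem_kill w X : flat X -> ~~ (X \subset zs w) -> fe w * idem X = 0.
Proof.
move: {2}#|X|.+1 (ltnSn #|X|) => n; elim: n w X => // n IH w X Xn fX Xw.
rewrite idemE mulrA feM; set v := w ** _.
have zv : zs v = zs w :&: X by rewrite zsM zs_flat_face.
rewrite mulrBr mulr1 mulr_sumr (bigID (fun Y => Y \subset zs v)) /=.
rewrite [X in _ - (_ + X)]big1 ?addr0; last first.
  move=> Y /andP[/andP[fY YX] Yv]; apply: IH => //.
  by rewrite (leq_trans (proper_card YX)).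
rewrite (eq_bigl (fun Y => flat Y && (Y \subset zs v))).
  by rewrite -mulr_sumr fe_idem_sum subrr.
move=> Y; case: (flat Y) => //=; apply/andP/idP => [[]//|Yv]; split=> //.
move: Yv; rewrite zv finset.subsetI => /andP[Yw YX].
by rewrite properE YX; apply: contra Xw => XY; apply: fintype.subset_trans Yw.
Qed.

Lemma sum_idem : \sum_(X | flat X) idem X = 1.
Proof.
have := fe_idem_sum mone; rewrite fe1 mul1r => <-.
by apply: eq_bigl => X; rewrite zs1 finset.subsetT andbT.
Qed.

Lemma idem_fe_idem_kill X Y w : flat Y -> ~~ (Y \subset X) -> flat X ->
  idem X * fe w * idem Y = 0.
Proof.
move=> fY; move: {2}#|X|.+1 (ltnSn #|X|) => n; elim: n X => // n IH X Xn YX fX.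
rewrite idemE mulrBr mulr1 !mulrBl feM fe_idem_kill //; last first.
  by rewrite zsM zs_flat_face //; apply: contra YX; rewrite finset.subsetI => /andP[].
rewrite sub0r -!mulrA mulr_suml mulr_sumr big1 ?oppr0 // => Z /andP[fZ ZX].
rewrite [idem Z * _]mulrA IH ?mulr0 //; first by rewrite (leq_trans (proper_card ZX)).
by apply: contra YX => YZ; apply: fintype.subset_trans (proper_sub ZX).
Qed.

(** e_X is a combination of faces spanning flats that contain X. *)
Lemma idem_mul_idem_kill X Y a : flat X -> flat Y -> ~~ (Y \subset X) ->
  idem X * a * idem Y = 0.
Proof.
move=> fX fY YX; elim/fe_ind: a => [|c w a IH]; first by rewrite mulr0 mul0r.
rewrite mulrDr mulrDl IH addr0 -scalerAr -scalerAl idem_fe_idem_kill //.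
exact: scaler0.
Qed.

Lemma idemM X Y : flat X -> flat Y -> idem X * idem Y = if X == Y then idem X else 0.
Proof.
move: {2}#|X|.+1 (ltnSn #|X|) => n; elim: n X Y => // n IH X Y Xn fX fY.
have IH' Z : flat Z && (Z \proper X) -> idem Z * idem Y = if Z == Y then idem Z else 0.
  by move=> /andP[fZ ZX]; apply: IH => //; rewrite (leq_trans (proper_card ZX)).
rewrite [in LHS]idemE -mulrA mulrBl mul1r mulr_suml (eq_bigr _ IH') -big_mkcondr.
case: (boolP (Y \proper X)) => YX.
  rewrite (big_pred1 Y) => [|Z]; last first.
    by rewrite /=; apply/andP/eqP => [[_ /eqP]//|->]; rewrite fY YX.
  by rewrite subrr mulr0; case: eqP YX => // ->; rewrite fintype.properxx.
rewrite big_pred0 => [|Z]; last by apply/negbTE; apply: contra YX => /andP[/andP[_ ?] /eqP <-].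
rewrite subr0; have [<-|XY] := eqVneq X Y.
  by rewrite {1}idemE mulrA feM mul_absorb ?fintype.subxx // -idemE.
by apply: fe_idem_kill; rewrite // zs_flat_face //; apply: contra YX; rewrite finset.properEneq eq_sym XY.
Qed.

Lemma fe_flat_idem X : fe (flat_face X) * idem X = idem X.
Proof. by rewrite {1}idemE mulrA feM mul_absorb ?fintype.subxx // -idemE. Qed.

Lemma idem_fe_idem X w : flat X ->
  idem X * fe w * idem X = if X \subset zs w then idem X else 0.
Proof.
move=> fX; case: ifP => [Xw|/negbT Xw]; last by rewrite -mulrA fe_idem_kill ?mulr0.
rewrite {1}idemE mulrBr mulr1 !mulrBl feM mul_absorb ?zs_flat_face // fe_flat_idem.
rewrite -!mulrA mulr_suml mulr_sumr big1 ?subr0 // => Z /andP[fZ ZX].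
by rewrite [idem Z * _]mulrA idem_fe_idem_kill ?mulr0 //; move: ZX; rewrite properE => /andP[].
Qed.

Lemma idem_line X a : flat X -> exists c : k, idem X * a * idem X = c *: idem X.
Proof.
move=> fX; elim/fe_ind: a => [|c w a [c' IH]]; first by exists 0; rewrite mulr0 mul0r scale0r.
rewrite mulrDr mulrDl IH -scalerAr -scalerAl idem_fe_idem //; case: ifP => _.
  by exists (c + c'); rewrite scalerDl.
by exists c'; rewrite scaler0 add0r.
Qed.

(** Dimensions are integers here, so that they can be shifted by a degree; out of
    range the idempotent is 0. *)
Fact eps_key : unit. Proof. by []. Qed.
Definition eps (i : int) : B :=
  locked_with eps_key (\sum_(X | flat X && ((fdim X)%:Z == i)) idem X).

Lemma epsE i : eps i = \sum_(X | flat X && ((fdim X)%:Z == i)) idem X.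
Proof. by rewrite /eps locked_withE. Qed.

Lemma eps_out i : (forall n : 'I_d.+1, i <> n%:Z) -> eps i = 0.
Proof.
move=> out; rewrite epsE big_pred0 // => X; apply/negbTE/negP => /andP[_ /eqP Xi].
have lt : (fdim X < d.+1)%N by rewrite ltnS fdim_le_d.
exact: (out (Ordinal lt)).
Qed.

Lemma sum_eps : \sum_(n < d.+1) eps n%:Z = 1.
Proof.
rewrite -sum_idem [RHS](partition_big (fun X => inord (fdim X) : 'I_d.+1) predT) //=.
apply: eq_bigr => n _; rewrite epsE; apply: eq_bigl => X; congr (_ && _).
apply/eqP/eqP => [[Xn]|<-]; first by apply: val_inj; rewrite /= inordK Xn.
by rewrite inordK // ltnS fdim_le_d.
Qed.

Lemma idem_eps X i : flat X -> idem X * eps i = if (fdim X)%:Z == i then idem X else 0.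
Proof.
move=> fX; rewrite epsE mulr_sumr.
under eq_bigr => Y /andP[fY _] do rewrite idemM //.
rewrite -big_mkcondr /=; case: ifP => Xi.
  rewrite (big_pred1 X) // => Y /=; apply/andP/eqP => [[_ /eqP]//|->].
  by rewrite fX Xi.
by rewrite big_pred0 // => Y; apply/negbTE/negP => /andP[/andP[_ Yi] /eqP XY]; rewrite XY Yi in Xi.
Qed.

Lemma eps_idem X i : flat X -> eps i * idem X = if (fdim X)%:Z == i then idem X else 0.
Proof.
move=> fX; rewrite epsE mulr_suml.
under eq_bigr => Y /andP[fY _] do rewrite idemM //.
rewrite -big_mkcondr /=; case: ifP => Xi.
  rewrite (big_pred1 X) // => Y /=; apply/andP/eqP => [[_ /eqP]//|->].
  by rewrite fX Xi.
by rewrite big_pred0 // => Y; apply/negbTE/negP => /andP[/andP[_ Yi] /eqP XY]; rewrite -XY Yi in Xi.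
Qed.

Lemma epsM i j : eps i * eps j = if i == j then eps i else 0.
Proof.
rewrite {1}epsE mulr_suml; under eq_bigr => X /andP[fX Xi] do rewrite idem_eps //.
case: ifP => [/eqP<-|ij].
  by rewrite epsE; apply: eq_bigr => X /andP[_ ->].
by rewrite big1 // => X /andP[_ /eqP->]; rewrite ij.
Qed.

Lemma eps_mul_eps i j a : j < i -> eps i * a * eps j = 0.
Proof.
move=> ji; rewrite !epsE !mulr_suml big1 // => X /andP[fX /eqP Xi].
rewrite mulr_sumr big1 // => Y /andP[fY /eqP Yj].
apply: idem_mul_idem_kill => //; apply/negP => /(fdimS L); rewrite -lez_nat Xi Yj.
by rewrite leNgt ji.
Qed.

Lemma idem_mul_idem_eq X Y a : flat X -> flat Y -> fdim X = fdim Y -> X != Y ->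
  idem X * a * idem Y = 0.
Proof.
move=> fX fY XY neq; apply: idem_mul_idem_kill => //; apply: contra neq => YX.
by apply/eqP/esym/(fdim_eq fY YX)/esym.
Qed.

End Idempotents.

(** * The grading by drop of dimension *)

Lemma direct_sum_projections (I : choiceType) (V : zmodType) (C : I -> {pred V})
    (p : I -> V -> V) (D : seq I) : uniq D ->
  (forall i v, p i v \in C i) ->
  (forall i j v, v \in C i -> p j v = if j == i then v else 0) ->
  (forall i, {morph p i : u v / u + v}) ->
  (forall i v, i \notin D -> p i v = 0) ->
  (forall v, v = \sum_(i <- D) p i v) -> is_direct_sum C.
Proof.
move=> Du pC pid pD pout psum v; pose F := seq_fset tt D.
have memF i : (i \in F) = (i \in D) by rewrite seq_fsetE.
pose c : {fsfun I -> V with 0} := [fsfun i in F => p i v].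
have cE i : c i = p i v.
  by rewrite fsfun_fun memF; case: ifPn => // /pout->.
exists c; split.
  split=> [i|]; first by rewrite cE.
  rewrite (fsum_widen (finsupp_sub _ _ _)) {1}[v]psum.
  rewrite (perm_big _ (seq_fset_perm tt D)) /= undup_id //; apply: eq_bigr => i _.
  by rewrite cE.
move=> c' [c'C vE]; apply/fsfunP => i; rewrite cE.
have p0 j : p j 0 = 0 by apply: (addrI (p j 0)); rewrite -pD !addr0.
rewrite vE (big_morph (p i) (pD i) (p0 i)).
have [ci|ci] := boolP (i \in finsupp c').
  rewrite (big_fsetD1 i) //= (pid i) // eqxx big1_seq ?addr0 // => j.
  by rewrite !inE => /andP[_ /andP[ji _]]; rewrite (pid j) // eq_sym (negbTE ji).
rewrite (fsfun_dflt ci) big1_seq // => j /andP[_ jc]; rewrite (pid j) //.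
by case: eqP => // ij; rewrite ij jc in ci.
Qed.

Section PathGrading.
Variables (R : realType) (d : nat) (A : {fset {vspace 'rV[R]_d}}).
Variables (L : labelling A) (k : fieldType) (B : algType k).
Local Notation face := (face L).
Local Notation "x ** y" := (@mmul face x y) (at level 40, left associativity).
Local Notation flat := (flat L).
Implicit Types (x y z w : face) (S T X Y Z : {set A}) (H : A) (a b : B).

Variable fe : face -> B.
Hypotheses (feM : forall x y, fe x * fe y = fe (x ** y)) (fe1 : fe mone = 1).
Hypothesis fe_ind : forall P : B -> Prop, P 0 ->
  (forall (c : k) w a, P a -> P (c *: fe w + a)) -> forall a, P a.

Local Notation idem := (idem fe).
Local Notation eps := (eps fe).
Local Notation epsM := (epsM feM).

Lemma eps_range_ind (P : int -> Prop) : (forall i, eps i = 0 -> P i) ->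
  (forall n : 'I_d.+1, P n%:Z) -> forall i, P i.
Proof.
move=> P0 Pn i; case: (pselect (exists n : 'I_d.+1, i = n%:Z)) => [[n ->]//|no].
by apply: P0; apply: eps_out => n iE; apply: no; exists n.
Qed.

Lemma eps_extl a b : (forall n : 'I_d.+1, eps n%:Z * a = eps n%:Z * b) -> a = b.
Proof.
move=> ab; rewrite -[a]mul1r -[b]mul1r -(sum_eps feM fe1) !mulr_suml.
exact: eq_bigr.
Qed.

Lemma eps_extr a b : (forall n : 'I_d.+1, a * eps n%:Z = b * eps n%:Z) -> a = b.
Proof.
move=> ab; rewrite -[a]mulr1 -[b]mulr1 -(sum_eps feM fe1) !mulr_sumr.
exact: eq_bigr.
Qed.

(** The piece e_X B e_Y is put in degree fdim Y - fdim X; the commutation rule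
    says that a is the sum of its parts eps (s - i) * a * eps s. *)
Definition hcomp (i : nat) : {pred B} :=
  [pred a | `[< forall s : int, a * eps s = eps (s - i%:Z) * a >]].

Lemma hcompP i a : reflect (forall s : int, a * eps s = eps (s - i%:Z) * a) (a \in hcomp i).
Proof. exact: asboolP. Qed.

Definition hproj (i : nat) a := \sum_(s < d.+1) eps (s%:Z - i%:Z) * a * eps s%:Z.

Lemma hproj_eps i a s : hproj i a * eps s = eps (s - i%:Z) * a * eps s.
Proof.
move: s; apply: eps_range_ind => [s ->|n]; first by rewrite !mulr0.
rewrite /hproj mulr_suml (bigD1 n) //= -mulrA epsM eqxx big1 ?addr0 // => m mn.
by rewrite -mulrA epsM eqz_nat (inj_eq val_inj) (negbTE mn) mulr0.
Qed.

Lemma eps_hproj i a s : eps (s - i%:Z) * hproj i a = eps (s - i%:Z) * a * eps s.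
Proof.
rewrite /hproj mulr_sumr; move: s; apply: eps_range_ind => [s es|n].
  rewrite es mulr0 big1 // => m _; rewrite !mulrA epsM.
  case: eqP => [/addIr sm|]; last by rewrite !mul0r.
  by rewrite -sm es mulr0.
rewrite (bigD1 n) //= !mulrA epsM eqxx big1 ?addr0 // => m mn.
rewrite !mulrA epsM (inj_eq (addIr _)) eqz_nat (inj_eq val_inj) eq_sym (negbTE mn).
by rewrite !mul0r.
Qed.

Lemma hproj_mem i a : hproj i a \in hcomp i.
Proof. by apply/hcompP => s; rewrite hproj_eps eps_hproj. Qed.

Lemma hproj_hom i j a : a \in hcomp i -> hproj j a = if j == i then a else 0.
Proof.
move=> /hcompP ai; apply: eps_extr => n; rewrite hproj_eps -mulrA ai mulrA epsM.
rewrite (inj_eq (addrI _)) eqr_opp eqz_nat; case: eqP => [->|_]; last by rewrite !mul0r.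
by rewrite ai.
Qed.

Lemma hprojD i : {morph hproj i : a b / a + b}.
Proof.
move=> a b; rewrite /hproj -big_split /=; apply: eq_bigr => s _.
by rewrite mulrDr mulrDl.
Qed.

Lemma eps_neg i : i < 0 -> eps i = 0.
Proof. by move=> i0; apply: eps_out => n iE; rewrite iE ltz_nat in i0. Qed.

Lemma hproj_out i a : i \notin iota 0 d.+1 -> hproj i a = 0.
Proof.
rewrite mem_iota add0n /= -leqNgt => di; rewrite /hproj big1 // => s _.
by rewrite eps_neg ?mul0r // subr_lt0 ltz_nat (leq_trans (ltn_ord s)).
Qed.

(** The parts of negative degree vanish by [eps_mul_eps]. *)
Lemma hproj_sum a : a = \sum_(i <- iota 0 d.+1) hproj i a.
Proof.
apply: eps_extr => s; apply: eps_extl => r.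
rewrite [X in _ = _ * X]mulr_suml [RHS]mulr_sumr.
have E i : eps r%:Z * (hproj i a * eps s%:Z) =
    if r%:Z == s%:Z - i%:Z then eps r%:Z * (a * eps s%:Z) else 0.
  rewrite hproj_eps !mulrA epsM; case: eqP => //; by rewrite !mul0r.
under eq_bigr => i _ do rewrite E.
rewrite -big_mkcond; case: (leqP r s) => rs.
  rewrite -big_filter.
  have -> : [seq i <- iota 0 d.+1 | r%:Z == s%:Z - i%:Z] = [:: (s - r)%N].
    rewrite (eq_in_filter (a2 := pred1 (s - r)%N)).
      rewrite filter_pred1_uniq ?iota_uniq // mem_iota add0n /=.
      by rewrite (leq_ltn_trans (leq_subr _ _)).
    by move=> i _ /=; apply/eqP/eqP; lia.
  by rewrite big_seq1.
rewrite big1 => [|i /eqP]; last by lia.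
by rewrite mulrA eps_mul_eps.
Qed.

Fact hcomp_submod i : GRing.submod_closed (hcomp i).
Proof.
split=> [|c a b /hcompP ai /hcompP bi]; first by apply/hcompP => s; rewrite mul0r mulr0.
by apply/hcompP => s; rewrite mulrDl mulrDr -scalerAl -scalerAr ai bi.
Qed.

Fact hcomp_direct : is_direct_sum hcomp.
Proof.
apply: (direct_sum_projections (iota_uniq 0 d.+1)).
- exact: hproj_mem.
- by move=> i j a; apply: hproj_hom.
- exact: hprojD.
- exact: hproj_out.
exact: hproj_sum.
Qed.

Fact hcompM i j a b : a \in hcomp i -> b \in hcomp j -> a * b \in hcomp (i + j)%N.
Proof.
move=> /hcompP ai /hcompP bj; apply/hcompP => s.
by rewrite -mulrA bj !mulrA ai PoszD opprD addrA addrAC.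
Qed.

Definition path_grading : grading B := Grading hcomp_submod hcomp_direct hcompM.

End PathGrading.

(** * The degree zero part is semisimple *)

Section DegreeZero.
Variables (R : realType) (d : nat) (A : {fset {vspace 'rV[R]_d}}).
Variables (L : labelling A) (k : fieldType) (B : algType k).
Local Notation face := (face L).
Local Notation "x ** y" := (@mmul face x y) (at level 40, left associativity).
Local Notation flat := (flat L).
Implicit Types (x y z w : face) (S T X Y Z : {set A}) (H : A) (a b : B).

Variable fe : face -> B.
Hypotheses (feM : forall x y, fe x * fe y = fe (x ** y)) (fe1 : fe mone = 1).
Hypothesis fe_ind : forall P : B -> Prop, P 0 ->
  (forall (c : k) w a, P a -> P (c *: fe w + a)) -> forall a, P a.
Hypothesis idem_neq0 : forall X, flat X -> idem fe X != 0.

Local Notation idem := (idem fe).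
Local Notation eps := (eps fe).
Local Notation G := (path_grading feM fe1 fe_ind).

Lemma idem_deg0 X : flat X -> idem X \in hcomp fe 0.
Proof.
by move=> fX; apply/hcompP => s; rewrite subr0 (idem_eps feM) // (eps_idem feM).
Qed.

(** Elements of degree 0 preserve dimension, and e_X B e_Y = 0 for distinct flats
    of the same dimension. *)
Lemma deg0_off X Y a : a \in hcomp fe 0 -> flat X -> flat Y -> X != Y ->
  idem X * a * idem Y = 0.
Proof.
move=> /hcompP a0 fX fY XY; have [dXY|dXY] := eqVneq (fdim X) (fdim Y).
  by apply: (idem_mul_idem_eq feM fe_ind).
have := idem_eps feM (fdim X)%:Z fX; rewrite eqxx => <-.
rewrite -(mulrA (idem X)) -[_%:Z]subr0 -a0 -!mulrA (eps_idem feM) // eqz_nat eq_sym.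
by rewrite (negbTE dXY) !mulr0.
Qed.

Lemma deg0_idem_r X a : a \in hcomp fe 0 -> flat X -> a * idem X = idem X * a * idem X.
Proof.
move=> a0 fX; rewrite -[LHS]mul1r -(sum_idem feM fe1) mulr_suml (bigD1 X) //=.
rewrite big1 => [|Y /andP[fY YX]]; first by rewrite addr0 mulrA.
by rewrite mulrA deg0_off.
Qed.

Local Notation A0 := (deg0 G).

Definition idem0 X (fX : flat X) : A0 := @Deg0 k B G (idem X) (idem_deg0 fX).

Let I := {X : {set A} | X \in flat}.

Definition block (i : I) : {pred A0^o} := [pred a : A0 | deg0_val a * idem (val i) == deg0_val a].

(** The degree zero part is the direct sum of the lines k e_X, by [idem_line] and
    [deg0_off]. *)
Lemma semisimple_deg0 : semisimple_ring A0.
Proof.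
have fl (i : I) : flat (val i) := valP i.
exists I, block; split=> [i|].
  have fi := valP i; split.
  - split=> [|c a b /eqP ai /eqP bi]; first by apply/eqP; rewrite /= mul0r.
    by apply/eqP; rewrite /= mulrDl -mulrA ai bi.
  - exists (idem0 fi : A0^o); first by apply/eqP; rewrite /= (idemM feM) // eqxx.
    by apply: contra (idem_neq0 fi) => /eqP/(congr1 val)/= ->.
  move=> N' [N'0 N'Z] N'N.
  case: (pselect (exists2 x, x \in N' & x != 0)) => [[x xN' x0]|no]; last first.
    left=> x xN'; apply: contrapT => /eqP x0; apply: no; by exists x.
  right=> y /eqP yN.
  have /eqP xi := N'N _ xN'.
  have x_deg0 : deg0_val x \in hcomp fe 0 by case: (x).
  have [c ec] := idem_line feM fe_ind (deg0_val x) fi.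
  have xE : deg0_val x = c *: idem (val i) by rewrite -xi (deg0_idem_r x_deg0 fi) ec.
  have c0 : c != 0.
    by apply: contra x0 => /eqP c0; apply/eqP/val_inj; rewrite /= xE c0 scale0r.
  have -> : y = ((c^-1 *: y : A0) : A0) *: x.
    apply: val_inj => /=; rewrite xE -scalerAr -scalerAl scalerA divff // scale1r.
    by rewrite yN.
  by have := N'Z (c^-1 *: y : A0) x 0 xN' N'0; rewrite addr0.
refine (@direct_sum_projections _ _ _ (fun (i : I) (a : A0^o) => ((a : A0) * idem0 (valP i) :
  A0^o)) (enum {: I}) _ _ _ _ _ _).
- exact: enum_uniq.
- move=> i a; apply/eqP; rewrite /= -mulrA (idemM feM) ?eqxx //; exact: (valP i).
- move=> i j a /eqP ai; apply: val_inj => /=; rewrite -ai -mulrA (idemM feM (fl i) (fl j)).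
  by rewrite eq_sym (inj_eq val_inj); case: eqP => _; rewrite ?ai ?mulr0.
- by move=> i a b; rewrite mulrDl.
- by move=> i a; rewrite mem_enum.
move=> a; rewrite -mulr_sumr -[LHS]mulr1; congr (_ * _).
apply: val_inj; rewrite raddf_sum /= big_enum /=.
by rewrite -(sum_idem feM fe1) (big_sub flat).
Qed.
End DegreeZero.

(** * The linear resolution *)

Section Submodules.
Variables (S : nzRingType) (V : lmodType S).

Record submodule := Submodule {
  submod_pred : {pred V};
  submod_predP : GRing.submod_closed submod_pred
}.

Record submod_type (N : submodule) : predArgType :=
  Submod { submod_val : V; _ : submod_val \in submod_pred N }.

Variable N : submodule.

HB.instance Definition _ := [isSub for @submod_val N].
HB.instance Definition _ := [Choice of submod_type N by <:].
HB.instance Definition _ := GRing.SubChoice_isSubLmodule.Build S V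
  (submod_pred N) (submod_type N) (submod_predP N).

Lemma submod_valP (m : submod_type N) : submod_val m \in submod_pred N.
Proof. by case: m. Qed.

End Submodules.

Lemma scaler_algC (k : fieldType) (B : algType k) (M : lmodType B) (c : k) (b : B) (m : M) :
  b *: (c%:A *: m) = c%:A *: (b *: m).
Proof. by rewrite !scalerA mulr_algr mulr_algl. Qed.

(** T stands for the face module with its basis of faces, bd Z for its boundary
    map in the flat Z, aug for the augmentation, and Tsupp q t says that t is
    spanned by faces whose flat satisfies q. *)
Section Resolution.
Variables (R : realType) (d : nat) (A : {fset {vspace 'rV[R]_d}}).
Variables (L : labelling A) (k : fieldType) (B : algType k).
Local Notation face := (face L).
Local Notation "x ** y" := (@mmul face x y) (at level 40, left associativity).
Local Notation flat := (flat L).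
Implicit Types (x y z w : face) (S X Y Z : {set A}) (H : A) (a b : B).

Variable fe : face -> B.
Hypotheses (feM : forall x y, fe x * fe y = fe (x ** y)) (fe1 : fe mone = 1).
Hypothesis fe_ind : forall P : B -> Prop, P 0 ->
  (forall (c : k) w a, P a -> P (c *: fe w + a)) -> forall a, P a.

Local Notation idem := (idem fe).
Local Notation eps := (eps fe).
Local Notation G := (path_grading feM fe1 fe_ind).
Local Notation flat_face := (flat_face L).

Variables (T : lmodType B) (bas : face -> T).
Hypothesis T_act : forall w x,
  fe w *: bas x = if zs x \subset zs w then bas (w ** x) else 0.

Variable Tsupp : pred {set A} -> T -> Prop.
Hypothesis Tsupp_closed : forall q a t t', Tsupp q t -> Tsupp q t' -> Tsupp q (a *: t + t').
Hypothesis Tsupp0 : forall q, Tsupp q 0.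
Hypothesis Tsupp_bas : forall (q : pred {set A}) x, q (zs x) -> Tsupp q (bas x).
Hypothesis Tsupp_ind : forall (q : pred {set A}) (P : T -> Prop), P 0 ->
  (forall (c : k) x t, q (zs x) -> Tsupp q t -> P t -> P (c%:A *: bas x + t)) ->
  forall t, Tsupp q t -> P t.

(** e_X is a combination of faces spanning flats that contain X, and such a face
    kills x unless its flat lies in that of x. *)
Lemma idem_bas_kill X x : ~~ (zs x \subset X) -> flat X -> idem X *: bas x = 0.
Proof.
move: {2}#|X|.+1 (ltnSn #|X|) => n; elim: n X => // n IH X Xn xX fX.
rewrite idemE -scalerA scalerBl scale1r scalerBr T_act zs_flat_face // (negbTE xX).
rewrite scaler_suml scaler_sumr big1 ?subrr // => Y /andP[fY YX].
rewrite IH ?scaler0 //; first by rewrite (leq_trans (proper_card YX)).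
by apply: contra xX => xY; apply: fintype.subset_trans (proper_sub YX).
Qed.

(** Apart from its leading face, all faces in e_X span flats larger than that of
    x, and kill x. *)
Lemma idem_bas x : idem (zs x) *: bas x = bas (flat_face (zs x)).
Proof.
rewrite idemE -scalerA scalerBl scale1r scalerBr T_act zs_flat_face ?flat_zs //.
rewrite fintype.subxx mul_absorb; last by rewrite zs_flat_face ?flat_zs ?fintype.subxx.
rewrite scaler_suml scaler_sumr big1 ?subr0 // => Y /andP[fY YX].
by rewrite idem_bas_kill ?scaler0 //; move: YX; rewrite properE => /andP[].
Qed.

Lemma eps_bas_kill i x : (fdim (zs x))%:Z < i -> eps i *: bas x = 0.
Proof.
move=> xi; rewrite epsE scaler_suml big1 // => X /andP[fX /eqP Xi].
apply: idem_bas_kill => //; apply/negP => /(fdimS L); rewrite -lez_nat Xi.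
by rewrite leNgt xi.
Qed.

Lemma eps_bas x : eps (fdim (zs x))%:Z *: bas x = bas (flat_face (zs x)).
Proof.
rewrite epsE scaler_suml (bigD1 (zs x)) ?flat_zs ?eqxx //= idem_bas.
rewrite big1 ?addr0 // => X /andP[/andP[fX /eqP[Xx]] neq].
apply: idem_bas_kill => //; apply: contra neq => xX.
by apply/eqP/esym/(fdim_eq (flat_zs x) xX)/esym.
Qed.

Definition in_deg Z (p : nat) : pred {set A} :=
  fun S => [&& flat Z, Z \subset S & (fdim S + p)%N == fdim Z].

(** The p-th term has one component for each flat Z, spanned by the faces of
    codimension p in Z. *)
Definition res_pred p : {pred {ffun {set A} -> T}} :=
  [pred m : {ffun {set A} -> T} | `[< forall Z, Tsupp (in_deg Z p) (m Z) >] ].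

Lemma res_predP p (m : {ffun {set A} -> T}) :
  reflect (forall Z, Tsupp (in_deg Z p) (m Z)) (m \in res_pred p).
Proof. exact: asboolP. Qed.

Fact res_closed p : GRing.submod_closed (res_pred p).
Proof.
split=> [|a m m' /res_predP mp /res_predP m'p]; apply/res_predP => Z; rewrite !ffunE //.
exact: Tsupp_closed.
Qed.

Definition res p := submod_type (Submodule (res_closed p)).

Lemma resP p (m : res p) Z : Tsupp (in_deg Z p) (submod_val m Z).
Proof. by have /res_predP := submod_valP m. Qed.

Definition mkres p (m : {ffun {set A} -> T}) (mp : forall Z, Tsupp (in_deg Z p) (m Z)) : res p :=
  @Submod _ _ (Submodule (res_closed p)) m (introT (res_predP p m) mp).

Lemma res_eq p (m m' : res p) :
  (forall Z, submod_val m Z = submod_val m' Z) -> m = m'.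
Proof. by move=> mm; apply/val_inj/ffunP. Qed.

Lemma resD p (m m' : res p) Z :
  submod_val (m + m') Z = submod_val m Z + submod_val m' Z.
Proof. by rewrite /= ffunE. Qed.

Lemma res0 p Z : submod_val (0 : res p) Z = 0.
Proof. by rewrite /= ffunE. Qed.

Lemma resZ p a (m : res p) Z : submod_val (a *: m) Z = a *: submod_val m Z.
Proof. by rewrite /= ffunE. Qed.

Lemma res_sum p (I : Type) (r : seq I) (P : pred I) (F : I -> res p) Z :
  submod_val (\sum_(i <- r | P i) F i) Z = \sum_(i <- r | P i) submod_val (F i) Z.
Proof.
by apply: (big_morph (fun m : res p => submod_val m Z)) => [m m'|]; rewrite ?resD ?res0.
Qed.

Definition res_inj p Z (t : T) : res p :=
  insubd (0 : res p) [ffun Y => if Y == Z then t else 0].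

Lemma res_injE p Z t Y : Tsupp (in_deg Z p) t ->
  submod_val (res_inj p Z t) Y = if Y == Z then t else 0.
Proof.
move=> Zt; rewrite /res_inj -[submod_val _]/(val _) insubdK ?ffunE //.
by apply/res_predP => W; rewrite ffunE; case: eqP => [->|_].
Qed.

Definition res_bas p Z x : res p := res_inj p Z (bas x).

Lemma res_basE p Z x Y : in_deg Z p (zs x) ->
  submod_val (res_bas p Z x) Y = if Y == Z then bas x else 0.
Proof. by move=> Zx; apply: res_injE; apply: Tsupp_bas. Qed.

Lemma res_ind p (P : res p -> Prop) : P 0 ->
  (forall (c : k) Z x m, in_deg Z p (zs x) -> P m -> P (c%:A *: res_bas p Z x + m)) ->
  forall m, P m.
Proof.
move=> P0 PD.
have Pinj Z t : Tsupp (in_deg Z p) t -> forall m, P m -> P (res_inj p Z t + m).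
  move: t; apply: Tsupp_ind => [m Pm|c x t Zx tp IH m Pm].
    have -> : res_inj p Z 0 = 0; last by rewrite add0r.
    by apply: res_eq => Y; rewrite res_injE // res0 if_same.
  have -> : res_inj p Z (c%:A *: bas x + t) = c%:A *: res_bas p Z x + res_inj p Z t.
    apply: res_eq => Y; rewrite resD resZ res_basE // !res_injE //; last first.
      by apply: Tsupp_closed => //; apply: Tsupp_bas.
    by case: eqP; rewrite ?scaler0 ?addr0.
  by rewrite -addrA; apply: PD => //; apply: IH.
move=> m; have -> : m = \sum_(Z : {set A}) res_inj p Z (submod_val m Z).
  apply: res_eq => Y; rewrite res_sum (bigD1 Y) //= res_injE ?eqxx; last exact: resP.
  rewrite big1 ?addr0 // => Z ZY; rewrite res_injE; last exact: resP.
  by rewrite eq_sym (negbTE ZY).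
by elim/big_rec: _ => // Z m' _; apply: Pinj; apply: resP.
Qed.

(** In the component of Z, degree j is where the idempotent of dimension fdim Z - j
    acts as the identity. A face x spanning a flat of codimension p in Z is
    generated by e_X x with X its flat, so the generators have degree p. *)
Definition res_comp p (j : int) : {pred res p} :=
  [pred m : res p | `[< forall Z, eps ((fdim Z)%:Z - j) *: submod_val m Z = submod_val m Z >] ].

Lemma res_compP p j (m : res p) : reflect
  (forall Z, eps ((fdim Z)%:Z - j) *: submod_val m Z = submod_val m Z) (m \in @res_comp p j).
Proof. exact: asboolP. Qed.

Fact res_comp_zmod p j : GRing.zmod_closed (@res_comp p j).
Proof.
split=> [|m m' /res_compP mj /res_compP m'j]; apply/res_compP => Z; rewrite /= !ffunE.
  by rewrite scaler0.
by rewrite scalerBr mj m'j.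
Qed.

Fact res_proj_subproof p j (m : res p) Z :
  Tsupp (in_deg Z p) ([ffun Z => eps ((fdim Z)%:Z - j) *: submod_val m Z] Z).
Proof.
by rewrite ffunE -[_ *: _]addr0; apply: Tsupp_closed => //; apply: resP.
Qed.

Definition res_proj p j (m : res p) : res p := mkres (@res_proj_subproof p j m).

Lemma res_projE p j (m : res p) Z :
  submod_val (res_proj j m) Z = eps ((fdim Z)%:Z - j) *: submod_val m Z.
Proof. by rewrite /= ffunE. Qed.

Lemma res_projD p j : {morph @res_proj p j : m m' / m + m'}.
Proof. by move=> m m'; apply: res_eq => Z; rewrite resD !res_projE resD scalerDr. Qed.

Lemma res_proj_mem p j (m : res p) : res_proj j m \in @res_comp p j.
Proof.
by apply/res_compP => Z; rewrite res_projE scalerA (epsM feM) eqxx.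
Qed.

Let degrees : seq int := [seq i%:Z - d%:Z | i <- iota 0 (d + d).+1].

Lemma sum_eps_shift Z : \sum_(j <- degrees) eps ((fdim Z)%:Z - j) = 1.
Proof.
apply: (eps_extl feM fe1) => n; rewrite mulr1 mulr_sumr big_map.
have nd := ltn_ord n; have Zd := fdim_le_d Z.
have E i : eps n%:Z * eps ((fdim Z)%:Z - (i%:Z - d%:Z)) =
    if i == (fdim Z + d - n)%N then eps n%:Z else 0.
  rewrite (epsM feM); congr (if _ then _ else _); apply/eqP/eqP; lia.
under eq_bigr => i _ do rewrite E.
rewrite -big_mkcond -big_filter.
rewrite filter_pred1_uniq ?iota_uniq // ?big_seq1 // mem_iota add0n /=.
lia.
Qed.

Fact res_comp_direct p : is_direct_sum (@res_comp p).
Proof.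
apply: (@direct_sum_projections _ _ _ (fun j m => res_proj j m) degrees).
- by rewrite map_inj_uniq ?iota_uniq // => i j /addIr[].
- by move=> j m; apply: res_proj_mem.
- move=> i j m /res_compP mi; apply: res_eq => Z; rewrite res_projE -mi scalerA (epsM feM).
  rewrite (inj_eq (addrI _)) eqr_opp; case: eqP => [->|_]; first by rewrite mi.
  by rewrite scale0r res0.
- by move=> j; apply: res_projD.
- move=> j m jD; apply: res_eq => Z; rewrite res_projE res0 (eps_out fe) ?scale0r //.
  move=> n jn; move/negP: jD; apply; apply/mapP; exists (fdim Z + d - n)%N.
    by rewrite mem_iota; have := ltn_ord n; have := fdim_le_d Z; lia.
  by have := ltn_ord n; lia.
move=> m; apply: res_eq => Z; rewrite res_sum.
under eq_bigr => j _ do rewrite res_projE.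
by rewrite -scaler_suml sum_eps_shift scale1r.
Qed.

Fact res_compZ p (i : nat) (j : int) a (m : res p) :
  a \in G i -> m \in @res_comp p j -> a *: m \in @res_comp p (i%:Z + j).
Proof.
move=> /hcompP ai /res_compP mj; apply/res_compP => Z.
rewrite resZ -{2}mj !scalerA ai.
by rewrite [i%:Z + j]addrC opprD addrA.
Qed.

Definition res_grading p : module_grading G (res p) :=
  ModuleGrading (@res_comp_zmod p) (@res_comp_direct p) (@res_compZ p).

(** The faces spanning a flat X form a copy of B e_X, generated by l_X. *)
Lemma res_bas_flat p Z x : in_deg Z p (zs x) ->
  (fe x * idem (zs x)) *: res_bas p Z (flat_face (zs x)) = res_bas p Z x.
Proof.
move=> Zx; have fx := flat_zs x; have zf := zs_flat_face fx.
have Zf : in_deg Z p (zs (flat_face (zs x))) by rewrite zf.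
apply: res_eq => Y; rewrite resZ !res_basE //; case: eqP; last by rewrite scaler0.
move=> _; have := idem_bas (flat_face (zs x)); rewrite zf -scalerA => ->.
by rewrite T_act zf fintype.subxx mul_absorb // zf fintype.subxx.
Qed.

(** No degree below p occurs by [eps_bas_kill]. In degree p + n, a face x spanning
    X is hit by eps (fdim X - n) * x * e_X, which has degree n, applied to the
    generator l_X. *)
Lemma res_generated p : generated_in_degree (res_grading p) p%:Z.
Proof.
split=> [j m jp /res_compP mj|n m].
  apply: res_eq => Z; rewrite res0 -mj.
  elim/(Tsupp_ind (q := in_deg Z p)): (submod_val m Z) / (resP m Z) => [|c x t Zx _ IH].
    exact: scaler0.
  rewrite scalerDr IH addr0 scaler_algC eps_bas_kill ?scaler0 //.
  by have /and3P[_ _ /eqP] := Zx; lia.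
split; last first.
  case=> s [sP ->]; rewrite big_seq; elim/big_ind: _ => [|m1 m2 m1P m2P|[a m'] /sP[aG mG]].
  - by have [] := @res_comp_zmod p (p%:Z + n%:Z).
  - rewrite -[m2]opprK; apply: (@res_comp_zmod p (p%:Z + n%:Z)).2 => //.
    rewrite -sub0r; apply: (@res_comp_zmod p (p%:Z + n%:Z)).2 => //.
    by have [] := @res_comp_zmod p (p%:Z + n%:Z).
  by rewrite addrC; apply: res_compZ.
move=> mG; have -> : m = res_proj (p%:Z + n%:Z) m.
  by apply: res_eq => Z; rewrite res_projE; have /res_compP-> := mG.
elim/res_ind: m {mG} => [|c Z x m Zx [s [sP IH]]].
  exists [::]; split=> //; rewrite big_nil.
  by apply: res_eq => Z; rewrite res_projE res0 scaler0.
have fx := flat_zs x; have zf := zs_flat_face fx.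
pose a := eps ((fdim (zs x))%:Z - n%:Z) * fe x * idem (zs x).
have aG : a \in G n.
  apply/hcompP => s'; rewrite /a -mulrA (idem_eps feM) // !mulrA (epsM feM).
  rewrite (inj_eq (addIr _)) eq_sym; case: eqP => [<-|_]; first by [].
  by rewrite mulr0 !mul0r.
have Zf : in_deg Z p (zs (flat_face (zs x))) by rewrite zf.
have fG : res_bas p Z (flat_face (zs x)) \in @res_comp p p%:Z.
  apply/res_compP => Y; rewrite res_basE //; case: eqP => [->|_]; last by rewrite scaler0.
  have -> : (fdim Z)%:Z - p%:Z = (fdim (zs (flat_face (zs x))))%:Z.
    by rewrite zf; have /and3P[_ _ /eqP] := Zx; lia.
  by rewrite eps_bas zf.
have E : res_proj (p%:Z + n%:Z) (c%:A *: res_bas p Z x) = (c *: a) *: res_bas p Z (flat_face (zs x)).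
  rewrite -[c *: a]mulr_algl -scalerA /a -mulrA -[X in _ = _ *: X]scalerA res_bas_flat //.
  apply: res_eq => Y; rewrite res_projE !resZ res_basE // scaler_algC.
  case: eqP => [->|_]; last by rewrite !scaler0.
  congr (_ *: (eps _ *: _)); have /and3P[_ _ /eqP <-] := Zx.
  by rewrite PoszD opprD addrA addrK.
exists ((c *: a, res_bas p Z (flat_face (zs x))) :: s); split.
  move=> q; rewrite inE => /predU1P[->|/sP//]; split=> //=.
  by have [_ GZ] := gcomp_submod G n; rewrite -[c *: a]addr0; apply: GZ => //; have [] := gcomp_submod G n.
by rewrite big_cons res_projD E IH.
Qed.


Lemma Tsupp_empty (q : pred {set A}) t : (forall X, ~~ q X) -> Tsupp q t -> t = 0.
Proof.
move=> q0; move: t; apply: Tsupp_ind => // c x t qx.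
by have := q0 (zs x); rewrite qx.
Qed.

Hypothesis T_hom : forall (M : lmodType B) (f : face -> M),
  (forall w x, fe w *: f x = if zs x \subset zs w then f (w ** x) else 0) ->
  exists h : {linear T -> M}, forall x, h (bas x) = f x.

Lemma fe_mul_idem_kill w x X : flat X -> zs x = X -> ~~ (X \subset zs w) ->
  fe w * (fe x * idem X) = 0.
Proof.
move=> fX xX Xw; rewrite mulrA feM (fe_idem_kill feM) // zsM finset.subsetI.
by rewrite (negbTE Xw).
Qed.

(** Each component is a sum of copies of the projective modules B e_X; a lift is
    given by x |-> x e_X m, where m lifts the image of the generator l_X. It
    respects the truncation because w x e_X = 0 unless w lies in X. *)
Lemma res_projective p : projective_module (res p).
Proof.
move=> M N g f g_onto.
have /choice[mm mmP] : forall ZX : {set A} * {set A},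
    exists m, g m = f (res_bas p ZX.1 (flat_face ZX.2)) by move=> ZX; apply: g_onto.
have /choice[hZ hZP] : forall Z, exists h : {linear T -> M}, forall x, h (bas x) =
    if in_deg Z p (zs x) then (fe x * idem (zs x)) *: mm (Z, zs x) else 0.
  move=> Z; apply: T_hom => w x; case: (boolP (zs x \subset zs w)) => xw.
    rewrite zsM (finset.setIidPr xw); case: ifP => _; last exact: scaler0.
    by rewrite scalerA mulrA feM.
  case: ifP => _; last exact: scaler0.
  by rewrite scalerA fe_mul_idem_kill ?scale0r ?flat_zs.
pose h (m : res p) : M := \sum_(Z : {set A}) hZ Z (submod_val m Z).
have h_linear : linear h.
  move=> a m m'; rewrite /h scaler_sumr -big_split; apply: eq_bigr => Z _.
  by rewrite resD resZ linearP.
pose hL := GRing.isLinear.Build B (res p) M *:%R h h_linear.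
exists (HB.pack h hL : {linear res p -> M}) => m /=.
have h0 : h 0 = 0 by rewrite /h big1 // => Z _; rewrite res0 linear0.
elim/res_ind: m => [|c Z x m Zx IH]; first by rewrite h0 !linear0.
rewrite h_linear !linearP /= IH; congr (_ *: _ + _).
have zf := zs_flat_face (flat_zs x).
have -> : h (res_bas p Z x) = (fe x * idem (zs x)) *: mm (Z, zs x).
  rewrite /h (bigD1 Z) //= res_basE // eqxx hZP Zx big1 ?addr0 // => Y YZ.
  by rewrite res_basE // (negbTE YZ) linear0.
by rewrite linearZ /= mmP -linearZ /= res_bas_flat.
Qed.

Variable bd : {set A} -> {linear T -> T}.
Hypothesis bd_supp : forall Z p t, Tsupp (in_deg Z p.+1) t -> Tsupp (in_deg Z p) (bd Z t).
Hypothesis bd_sq : forall Z t, bd Z (bd Z t) = 0.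

Fact res_d_subproof p (m : res p.+1) Z :
  Tsupp (in_deg Z p) ([ffun Z => bd Z (submod_val m Z)] Z).
Proof. by rewrite ffunE; apply/bd_supp/resP. Qed.

Definition res_d p (m : res p.+1) : res p := mkres (res_d_subproof m).

Lemma res_dE p (m : res p.+1) Z : submod_val (res_d m) Z = bd Z (submod_val m Z).
Proof. by rewrite /= ffunE. Qed.

Fact res_d_linear p : linear (@res_d p).
Proof.
by move=> a m m'; apply: res_eq => Z; rewrite resD resZ !res_dE resD resZ linearP.
Qed.

HB.instance Definition _ p := GRing.isLinear.Build B (res p.+1) (res p) *:%R
  (@res_d p) (@res_d_linear p).

Lemma res_d_degree p : has_degree (res_grading p.+1) (res_grading p) 0 (@res_d p).
Proof.
move=> i m /res_compP mi; apply/res_compP => Z.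
by rewrite addr0 !res_dE -[in RHS]mi linearZ.
Qed.

Variable aug : T -> k.
Hypothesis aug0 : aug 0 = 0.
Hypothesis augP : forall c x t, aug (c%:A *: bas x + t) = c + aug t.
Hypothesis aug_bd : forall Z t, aug (bd Z t) = 0.
Hypothesis bd_exact : forall Z p t, flat Z -> Tsupp (in_deg Z p) t ->
  (if p is 0%N then aug t = 0 else bd Z t = 0) ->
  exists2 t', Tsupp (in_deg Z p.+1) t' & bd Z t' = t.
Hypothesis idem_neq0 : forall X, flat X -> idem X != 0.

(** Exactness holds for each flat Z separately. *)
Lemma res_lift p (m : res p) :
  (forall Z, flat Z -> if p is 0%N then aug (submod_val m Z) = 0
                       else bd Z (submod_val m Z) = 0) ->
  exists m' : res p.+1, res_d m' = m.
Proof.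
move=> cyc; have /choice[t tP] : forall Z, exists t',
    Tsupp (in_deg Z p.+1) t' /\ bd Z t' = submod_val m Z.
  move=> Z; case: (boolP (flat Z)) => fZ.
    by have [t' ? ?] := bd_exact fZ (resP m Z) (cyc Z fZ); exists t'.
  exists 0; split=> //; rewrite linear0; apply/esym/(Tsupp_empty _ (resP m Z)) => X.
  by rewrite /in_deg (negbTE fZ).
have tT Z : Tsupp (in_deg Z p.+1) ([ffun Z => t Z] Z) by rewrite ffunE; case: (tP Z).
by exists (mkres tT); apply: res_eq => Z; rewrite res_dE /= ffunE; case: (tP Z).
Qed.

Lemma res_exact p (m : res p.+1) : res_d m = 0 <-> exists m' : res p.+2, res_d m' = m.
Proof.
split=> [m0|[m' <-]]; last by apply: res_eq => Z; rewrite !res_dE bd_sq res0.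
by apply: res_lift => Z _; rewrite -res_dE m0 res0.
Qed.

Local Notation D0 := (deg0_module G).

Lemma hcomp_diag X (i : nat) b : flat X -> i != 0%N -> b \in hcomp fe i ->
  idem X * b * idem X = 0.
Proof.
move=> fX i0 /hcompP bi.
have eX : eps (fdim X)%:Z * idem X = idem X by rewrite (eps_idem feM) // eqxx.
rewrite -eX mulrA -(mulrA _ b) bi mulrA -(mulrA _ (idem X)) (idem_eps feM) //.
case: eqP => [|_]; last by rewrite mulr0 !mul0r.
by move/eqP: i0; lia.
Qed.

(** Only the degree 0 part of a survives in e_X a e_X. *)
Lemma deg0_actE a X (y : deg0 G) : flat X -> deg0_val y = idem X ->
  deg0_val (a *: (y : D0)) = idem X * a * idem X.
Proof.
move=> fX yX; rewrite /= yX [LHS](deg0_idem_r feM fe1 fe_ind (gproj_mem G a 0) fX).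
have [D aE] := gprojE G a; rewrite (gproj0_sum aE) [in RHS]aE.
rewrite !mulr_sumr !mulr_suml; apply: eq_bigr => i _.
case: eqP => [//|/eqP i0]; by rewrite mulr0 mul0r (hcomp_diag fX i0 (gproj_mem G a i)).
Qed.

Definition deg0_idem X : D0 := insubd (0 : deg0 G) (idem X).

Lemma deg0_idemE X : flat X -> deg0_val (deg0_idem X) = idem X.
Proof. by move=> fX; rewrite -[deg0_val _]/(val _) insubdK //; apply: (idem_deg0 feM). Qed.

Lemma in_deg0 Z X : flat X -> in_deg Z 0 X -> X = Z.
Proof.
move=> fX /and3P[fZ ZX]; rewrite addn0 => /eqP XZ.
by apply/esym/(fdim_eq fZ).
Qed.

Lemma deg0_valD (y y' : D0) : deg0_val (y + y') = deg0_val y + deg0_val y'.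
Proof. by []. Qed.

Lemma deg0_val_inj (y y' : D0) : deg0_val y = deg0_val y' -> y = y'.
Proof. exact: val_inj. Qed.

Lemma deg0_val_sum (I : Type) (r : seq I) (P : pred I) (F : I -> D0) :
  deg0_val (\sum_(i <- r | P i) F i) = \sum_(i <- r | P i) deg0_val (F i).
Proof. by apply: (big_morph (fun y : D0 => deg0_val y)) => [y y'|]. Qed.

(** In degree 0 the only flat in the component of Z is Z, and its faces all map
    to e_Z. *)
Lemma augmentation_ex : exists f : {linear res 0 -> D0},
  forall m, deg0_val (f m) = \sum_(Z | flat Z) aug (submod_val m Z) *: idem Z.
Proof.
have /choice[fZ fZP] : forall Z, exists f : {linear T -> D0}, forall x, f (bas x) =
    if in_deg Z 0 (zs x) then deg0_idem Z else 0.
  move=> Z; apply: T_hom => w x; case: (boolP (in_deg Z 0 (zs x))) => Zx; last first.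
    rewrite scaler0; case: ifP => // xw; rewrite zsM (finset.setIidPr xw).
    by rewrite (negbTE Zx).
  have xZ := in_deg0 (flat_zs x) Zx; have fZ : flat Z by rewrite -xZ flat_zs.
  apply: deg0_val_inj; rewrite (deg0_actE _ fZ (deg0_idemE fZ)).
  rewrite (idem_fe_idem feM) // xZ; case: ifP => // Zw.
  have ZZ : in_deg Z 0 Z by rewrite -{2}xZ.
  by rewrite zsM xZ (finset.setIidPr Zw) ZZ deg0_idemE.
pose f (m : res 0) : D0 := \sum_(Z | flat Z) fZ Z (submod_val m Z).
have f_linear : linear f.
  move=> a m m'; rewrite /f scaler_sumr -big_split; apply: eq_bigr => Z _.
  by rewrite resD resZ linearP.
pose fL := GRing.isLinear.Build B (res 0) D0 *:%R f f_linear.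
exists (HB.pack f fL : {linear res 0 -> D0}) => m.
rewrite [LHS]deg0_val_sum; apply: eq_bigr => Z flatZ.
move: (submod_val m Z) (resP m Z); apply: Tsupp_ind => [|c x t Zx _ IH].
  by rewrite linear0 aug0 scale0r.
rewrite linearP deg0_valD IH fZP Zx (deg0_actE _ flatZ (deg0_idemE flatZ)) augP scalerDl.
by rewrite mulr_algr -scalerAl (idemM feM) // eqxx.
Qed.

Lemma eps_deg0 i : eps i \in G 0.
Proof.
apply/hcompP => s; rewrite subr0 !(epsM feM) eq_sym.
by case: eqP => [->|].
Qed.

Lemma deg0_eps i (y : D0) : deg0_val (eps i *: y) = eps i * deg0_val y.
Proof. by rewrite /= (gproj_hom (eps_deg0 i)) eqxx. Qed.

Theorem res_linear_resolution : has_linear_resolution (deg0_grading G).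
Proof.
have [f fE] := augmentation_ex.
have f_bas Z : flat Z -> f (res_bas 0 Z (flat_face Z)) = deg0_idem Z.
  move=> fZ; have Zf : in_deg Z 0 (zs (flat_face Z)).
    by rewrite zs_flat_face // /in_deg fZ fintype.subxx addn0 eqxx.
  apply: deg0_val_inj; rewrite fE deg0_idemE // (bigD1 Z) //= res_basE // eqxx.
  rewrite big1 ?addr0 => [|Y /andP[_ YZ]]; last by rewrite res_basE // (negbTE YZ) aug0 scale0r.
  by rewrite -[bas _]addr0 -[bas _]scale1r -[1 : B]scale1r augP aug0 addr0 scale1r.
have f_coef m Z : flat Z -> deg0_val (f m) * idem Z = aug (submod_val m Z) *: idem Z.
  move=> fZ; rewrite fE mulr_suml (bigD1 Z) //= -scalerAl (idemM feM) // eqxx.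
  rewrite big1 ?addr0 // => Y /andP[fY YZ].
  by rewrite -scalerAl (idemM feM) // (negbTE YZ) scaler0.
exists res, res_grading, f, (fun i => @res_d i : {linear res i.+1 -> res i}); split.
- exact: res_projective.
- exact: res_generated.
- split=> [i m /res_compP mi|]; last exact: res_d_degree.
  rewrite addr0 !inE; case: eqP => //= i0; apply/eqP/deg0_val_inj.
  (* The component at Z of an element of degree i is fixed by the idempotent of
     dimension fdim Z - i, which kills e_Z for nonzero i. *)
  rewrite fE big1 // => Z fZ; rewrite -f_coef //.
  set m' := res_inj 0 Z (submod_val m Z).
  have m'Z : submod_val m' Z = submod_val m Z by rewrite res_injE ?eqxx //; apply: resP.
  have m'E : m' = eps ((fdim Z)%:Z - i) *: m'.
    apply: res_eq => Y; rewrite resZ res_injE; last exact: resP.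
    by case: eqP => _; rewrite ?mi ?scaler0.
  rewrite f_coef // -m'Z -f_coef // m'E linearZ deg0_eps -mulrA f_coef //.
  rewrite -scalerAr (eps_idem feM) //; case: eqP => [|_]; last by rewrite scaler0.
  by move/eqP: i0; lia.
- move=> y; exists (\sum_(Z | flat Z) deg0_val y *: res_bas 0 Z (flat_face Z)).
  rewrite linear_sum; apply: deg0_val_inj; rewrite deg0_val_sum.
  rewrite -[RHS]mulr1 -(sum_idem feM fe1) mulr_sumr; apply: eq_bigr => Z fZ.
  have y0 : deg0_val y \in hcomp fe 0 by case: (y).
  by rewrite linearZ f_bas // (deg0_actE _ fZ (deg0_idemE fZ)) (deg0_idem_r feM fe1 fe_ind y0 fZ).
split; last by move=> i m; apply: res_exact.
move=> m; split=> [m0|[m' <-]]; last first.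
  by apply: deg0_val_inj; rewrite fE big1 // => Z _; rewrite res_dE aug_bd scale0r.
apply: res_lift => Z fZ; have := f_coef m Z fZ; rewrite m0 mul0r => /esym/eqP.
by rewrite scaler_eq0 (negbTE (idem_neq0 fZ)) orbF => /eqP.
Qed.

End Resolution.

(** * The face algebra is Koszul *)

Section RestrictScalars.
Variables (k : fieldType) (B : algType k) (M : lmodType B).

Definition restrict_scalars : Type := M.
HB.instance Definition _ := GRing.Zmodule.on restrict_scalars.

Definition restr_scale (c : k) (m : restrict_scalars) : restrict_scalars :=
  c%:A *: (m : M).

Fact restr_scaleA a b m : restr_scale a (restr_scale b m) = restr_scale (a * b) m.
Proof. by rewrite /restr_scale scalerA mulr_algl scalerA. Qed.

Fact restr_scale1 : left_id 1 restr_scale.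
Proof. by move=> m; rewrite /restr_scale !scale1r. Qed.

Fact restr_scaleDr : right_distributive restr_scale +%R.
Proof. by move=> a m m'; rewrite /restr_scale scalerDr. Qed.

Fact restr_scaleDl m : {morph restr_scale^~ m : a b / a + b}.
Proof. by move=> a b; rewrite /restr_scale !scalerDl. Qed.

HB.instance Definition _ := GRing.Zmodule_isLmodule.Build k restrict_scalars
  restr_scaleA restr_scale1 restr_scaleDr restr_scaleDl.

End RestrictScalars.

Section FaceModule.
Variables (R : realType) (d : nat) (A : {fset {vspace 'rV[R]_d}}).
Variables (L : labelling A) (k : fieldType).
Local Notation face := (face L).
Local Notation chain := {malg k[face]}.
Local Notation alg := (face_algebra L k).
Local Notation T := (truncated L k).
Local Notation "x ** y" := (@mmul face x y) (at level 40, left associativity).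
Implicit Types (x y w : face) (X Y Z : {set A}).

Let fe w : alg := << w >>.
Let bas x : T := << x >>.

Definition chain_supp (q : pred {set A}) (t : T) : Prop :=
  supp_in [pred x | q (zs x)] (t : chain).

Lemma face_act w x :
  fe w *: bas x = if zs x \subset zs w then bas (w ** x) else 0.
Proof. by rewrite [LHS]actU act1U. Qed.

Lemma scalar_act (c : k) (t : T) : c%:A *: t = (c *: (t : chain)) :> chain.
Proof. by rewrite [LHS]act_scale act_one. Qed.

Lemma chain_supp_closed q (a : alg) (t t' : T) :
  chain_supp q t -> chain_supp q t' -> chain_supp q (a *: t + t').
Proof.
move=> qt qt'; apply: supp_inD qt'; rewrite -[a *: t]/(act a t).
elim/alg_ind: a => [|c w a IH]; first by rewrite act0; apply: supp_in0.
rewrite actP actU; apply: supp_in_linear => //; apply: supp_in_lin => x /qt qx.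
rewrite /trunc; case: ifP => xw; last exact: supp_in0.
by apply: supp_inU; rewrite /= zsM (finset.setIidPr xw).
Qed.

Lemma chain_supp_bas (q : pred {set A}) x : q (zs x) -> chain_supp q (bas x).
Proof. by move=> qx; apply: supp_inU. Qed.

Lemma chain_supp_ind (q : pred {set A}) (P : T -> Prop) : P 0 ->
  (forall (c : k) x t, q (zs x) -> chain_supp q t -> P t -> P (c%:A *: bas x + t)) ->
  forall t, chain_supp q t -> P t.
Proof.
move=> P0 PD t qt; rewrite [t](malg_sum (t : chain)) big_seq.
suff [] : P (\sum_(x <- msupp (t : chain) | x \in msupp (t : chain))
               (t : chain)@_x *: (<< x >> : chain)) /\
    chain_supp q (\sum_(x <- msupp (t : chain) | x \in msupp (t : chain))
               (t : chain)@_x *: (<< x >> : chain)) by [].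
elim/big_rec: _ => [|x t' xt [Pt' qt']]; first by split=> //; apply: supp_in0.
rewrite -scalar_act; split; first by apply: PD => //; apply: qt.
by apply: chain_supp_closed => //; apply/chain_supp_bas/qt.
Qed.

(** A module map out of T is the same as a family of elements compatible with the
    action of faces on the basis. *)
Lemma chain_hom (M : lmodType alg) (f : face -> M) :
  (forall w x, fe w *: f x = if zs x \subset zs w then f (w ** x) else 0) ->
  exists h : {linear T -> M}, forall x, h (bas x) = f x.
Proof.
move=> fP; pose h (t : T) : M := lin (f : face -> restrict_scalars M) (t : chain).
have hP (c : k) (t t' : chain) : h (c *: t + t') = c%:A *: h t + h t' :=
  @linP k face (restrict_scalars M) f c t t'.
have hU x : h << x >> = f x  := @linU k face (restrict_scalars M) f x.
have h0 : h 0 = 0 := @lin0 k face (restrict_scalars M) f.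
have hD (t t' : chain) : h (t + t') = h t + h t'.
  by have := hP 1 t t'; rewrite !scale1r.
have h_face w (t : chain) : h (act1 w t) = fe w *: h t.
  elim/malg_ind: t => [|c x t IH]; first by rewrite act10 h0 scaler0.
  rewrite act1P !hP scalerDr IH scaler_algC act1U /trunc hU fP.
  by case: ifP => _; rewrite ?hU ?h0.
have h_act (a : alg) (t : chain) : h (act a t) = a *: h t.
  elim/alg_ind: a => [|c w a IH]; first by rewrite act0 h0 scale0r.
  by rewrite actP hP IH actU h_face scalerA mulr_algl scalerDl.
have h_linear : linear h by move=> a t t'; rewrite -h_act -hD.
pose hL := GRing.isLinear.Build alg T M *:%R h h_linear.
by exists (HB.pack h hL : {linear T -> M}).
Qed.

Variables (u : {set A} -> 'rV[R]_d) (uP : generic_directions u).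

Fact bdry_module_linear Z : linear (bdry u Z : T -> T).
Proof.
move=> a t t'; have bD (c c' : chain) : bdry u Z (c + c') = bdry u Z c + bdry u Z c'.
  by have := bdryP u Z 1 c c'; rewrite !scale1r.
change (bdry u Z (act a t + t' : chain) = act a (bdry u Z t) + bdry u Z t' :> chain).
by rewrite (act_bdry uP) bD.
Qed.

Definition bdry_module Z : {linear T -> T} :=
  HB.pack (bdry u Z : T -> T)
    (GRing.isLinear.Build alg T T *:%R (bdry u Z : T -> T) (bdry_module_linear Z)).

Lemma bdry_module_supp Z p t :
  chain_supp (in_deg L Z p.+1) t -> chain_supp (in_deg L Z p) (bdry_module Z t).
Proof.
move=> tp; apply: (@supp_in_lin k face face) => x /tp /and3P[fZ Zx /eqP xp].
rewrite -(@bdryU R d A L k u); apply: (supp_in_sub _ (@mem_bdry1 _ _ _ _ k _ uP _ _)) => y /=.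
by case/and4P=> Zy _ /eqP dy _; rewrite /in_deg fZ Zy dy addSnnS xp eqxx.
Qed.

Lemma bdry_module_exact Z p (t : T) : flat L Z -> chain_supp (in_deg L Z p) t ->
  (if p is 0%N then aug (t : chain) = 0 else bdry_module Z t = 0) ->
  exists2 t', chain_supp (in_deg L Z p.+1) t' & bdry_module Z t' = t.
Proof.
move=> /flatP[z <-] tp cyc.
have degE q (x : face) :
    in_deg L (zs z) q (zs x) = (zs z \subset zs x) && codim_in z q x.
  by rewrite /in_deg flat_zs.
have [||p0|t' t'p <-] := @bdry_exact R d A L k u uP z p t.
- by apply: supp_in_sub tp => x /=; rewrite degE.
- case: p => [|//] in tp cyc *.
  apply: (@supp_in_none k face pred0); last by [].
  apply: (@supp_in_lin k face face) => x /tp; rewrite /= degE => /andP[zx /eqP xp].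
  rewrite -(@bdryU R d A L k u); apply: (supp_in_sub _ (@mem_bdry1 _ _ _ _ k _ uP _ _)) => y /=.
  case/and4P=> /(fdimS L); rewrite -xp addn0 => le _ /eqP dy.
  by rewrite dy ltnn in le.
- by rewrite p0 in cyc.
by exists t' => //; apply: supp_in_sub t'p => x /=; rewrite degE.
Qed.

Let feM : forall x y, fe x * fe y = fe (x ** y) := @algUM R d A L k.
Let fe1 : fe mone = 1 := erefl.
Let fe_ind := @alg_ind R d A L k.

(** e_X fixes l_X in the face module. *)
Lemma idem_face_neq0 X : flat L X -> idem fe X != 0.
Proof.
move=> fX; apply/negP => /eqP e0.
have := idem_bas face_act (flat_face L X); rewrite zs_flat_face // e0 scale0r.
move/(congr1 (mcoeff (flat_face L X))); rewrite mcoeffU eqxx mcoeff0 => /esym/eqP.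
by rewrite oner_eq0.
Qed.

Theorem face_algebra_koszul : koszul (path_grading feM fe1 fe_ind).
Proof.
split; first exact: (semisimple_deg0 feM fe1 fe_ind idem_face_neq0).
apply: (@res_linear_resolution R d A L k alg fe feM fe1 fe_ind T bas face_act
  chain_supp chain_supp_closed _ chain_supp_bas chain_supp_ind chain_hom
  bdry_module bdry_module_supp _ (fun t => aug (t : chain)) _ _ _
  bdry_module_exact idem_face_neq0).
- by move=> q; apply: supp_in0.
- by move=> Z t; apply: bdry_sq.
- exact: aug0.
- by move=> c x t; rewrite scalar_act augP augU mulr1.
by move=> Z t; apply: aug_bdry.
Qed.

End FaceModule.

Theorem proposition9p4 (k : fieldType) (R : realType) (d : nat)
    (A : {fset {vspace 'rV[R]_d}})
    (hyperplanes : forall H, H \in A -> (\dim H).+1 = d)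
    (L : labelling A) :
  exists G : grading (face_algebra L k), koszul G.
Proof.
have [u uP] := generic_directions_ex L.
by eexists; exact: (face_algebra_koszul L k uP).
Qed.
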